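(* With the notation of the context, the following hold: (i) $K_{\mathbb{R}}=\overline{W^u(0)}\cup W^u_-(p,p')\cup\{p,p'\}$; (ii) $K^+_{\mathbb{R}}=\Omega_+\cup\Omega_-\cup W^s(0)\cup W^s(p,p')$; (iii) $K^-_{\mathbb{R}}=\overline{W^u(0)}\cup W^u(p,p')$; (iv) $J^+_{\mathbb{R}}=W^s(0)\cup W^s(p,p')$; (v) $J^-_{\mathbb{R}}=K^-_{\mathbb{R}}$; (vi) $J_{\mathbb{R}}=\{0,p,p'\}\cup\bigl(W^u_-(p,p')\cap W^s(0)\bigr)$.
   Context: Let $f(z,w)=(w,\tfrac{z}{2}-w^3+\tfrac34 w)$, a polynomial automorphism of $\mathbb{C}^2$ which restricts to a bijection of $\mathbb{R}^2$, $f(x,y)=(y,\tfrac{x}{2}-y^3+\tfrac34 y)$, with inverse $f^{-1}(x,y)=(2x^3-\tfrac32x+2y,x)$. Its real fixed points include $0=(0,0)$, a saddle, and $p_+=(\tfrac12,\tfrac12)$, $p_-=(-\tfrac12,-\tfrac12)$, which are attracting. The points $p=(-\tfrac{\sqrt5}{2},\tfrac{\sqrt5}{2})$ and $p'=(\tfrac{\sqrt5}{2},-\tfrac{\sqrt5}{2})$ form a saddle cycle of period two. Julia sets: $K^+$ (resp. $K^-$) is the set of points of $\mathbb{C}^2$ with bounded forward (resp. backward) orbit under $f$, and $K=K^+\cap K^-$. $J^{+}=\partial K^{+}$ and $J^-=\partial K^-$ (boundaries in $\mathbb{C}^2$), and $J=J^+\cap J^-$. The subscript $\mathbb{R}$ denotes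 intersection with $\mathbb{R}^2$: $K_{\mathbb{R}}=K\cap\mathbb{R}^2$, $K^\pm_{\mathbb{R}}=K^\pm\cap\mathbb{R}^2$, $J^\pm_{\mathbb{R}}=J^\pm\cap\mathbb{R}^2$, $J_{\mathbb{R}}=J\cap\mathbb{R}^2$. Basins and invariant manifolds, all in $\mathbb{R}^2$: $\Omega_\pm=\{q\in\mathbb{R}^2: f^n(q)\to p_\pm\}$; $W^s(0)=\{q\in\mathbb{R}^2: f^n(q)\to0\}$; $W^u(0)=\{q\in\mathbb{R}^2: f^{-n}(q)\to 0\}$; $W^s(p,p')=\{q\in\mathbb{R}^2: d(f^n(q),\{p,p'\})\to0\}$; $W^u(p,p')=\{q\in\mathbb{R}^2: d(f^{-n}(q),\{p,p'\})\to0\}$ (limits as $n\to\infty$, $d$ Euclidean distance). The bar denotes closure in $\mathbb{R}^2$. The branch $W^u_-(p,p')$: let $Q_3=\{(x,y)\in\mathbb{R}^2: x\le-\tfrac{\sqrt5}{2},\ y\ge\tfrac{\sqrt5}{2}\}$ and $Q_3'=-Q_3$. There is an unstable eigenvector $v$ of $Df^2(p)$ pointing into the interior of $Q_3$ (i.e. $p+tv\in \operatorname{int}Q_3$ for $t>0$), and a smooth injective parametrization $\Gamma:\mathbb{R}\to\mathbb{R}^2$ of the unstable manifold $W^u_{f^2}(p)$ of $p$ with respect to $f^2$, with $\Gamma(0)=p$ and having $v$ as its tangent at $p$. Similarly $\Gamma'$ parametrizes $W^u_{f^2}(p')$, with $p$, $Q_3$ replaced by $p'$, $Q_3'$. With $\mathbb{R}_-$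 the negative and $\mathbb{R}_+$ the positive real numbers, $W^u_-(p,p')=\Gamma(\mathbb{R}_-)\cup\Gamma'(\mathbb{R}_-)$ and $W^u_+(p,p')=\Gamma(\mathbb{R}_+)\cup\Gamma'(\mathbb{R}_+)$, so that $W^u(p,p')=W^u_-(p,p')\cup W^u_+(p,p')\cup\{p,p'\}$. *)

(* Defs.v *)
From HB Require Import structures.
From mathcomp Require Import all_boot all_order all_algebra.
From mathcomp Require Import complex ring.
From mathcomp Require Import all_classical all_reals all_analysis.

Import Order.TTheory GRing.Theory Num.Theory numFieldNormedType.Exports.

Local Open Scope complex_scope.
Local Open Scope classical_set_scope.
Local Open Scope ring_scope.

Section Henon.
Variable F : numFieldType.

Definition henon (q : F * F) : F * F :=
  (q.2, q.1 / 2 - q.2 ^+ 3 + 3 / 4 * q.2).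

Definition henon_inv (q : F * F) : F * F :=
  (2 * q.1 ^+ 3 - 3 / 2 * q.1 + 2 * q.2, q.1).

Lemma henonK : cancel henon henon_inv.
Proof. by case=> x y; rewrite /henon /henon_inv /=; congr pair; field. Qed.

Lemma henon_invK : cancel henon_inv henon.
Proof. by case=> x y; rewrite /henon /henon_inv /=; congr pair; field. Qed.

End Henon.

Section Sets.
Variable R : realType.

Notation R2 := (R * R)%type.

(* [R[i]] gets its modulus topology only through the alias [_^o]. *)
Notation C2 := (R[i]^o * R[i]^o)%type.

Definition fC : C2 -> C2 := henon R[i].
Definition fCinv : C2 -> C2 := henon_inv R[i].
Definition fR : R2 -> R2 := henon R.
Definition fRinv : R2 -> R2 := henon_inv R.

Definition boundary {T : topologicalType} (A : set T) : set T :=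
  closure A `\` A°.

Definition bounded_orbit (g : C2 -> C2) (q : C2) : Prop :=
  bounded_set (range (fun n => iter n g q)).

Definition Kplus : set C2 := [set q | bounded_orbit fC q].
Definition Kminus : set C2 := [set q | bounded_orbit fCinv q].
Definition K : set C2 := Kplus `&` Kminus.
Definition Jplus : set C2 := boundary Kplus.
Definition Jminus : set C2 := boundary Kminus.
Definition J : set C2 := Jplus `&` Jminus.

Definition real_pt (q : R2) : C2 := (q.1%:C, q.2%:C).
Definition real_slice (A : set C2) : set R2 := real_pt @^-1` A.

Definition orig : R2 := (0, 0).
Definition p_plus : R2 := (1 / 2, 1 / 2).
Definition p_minus : R2 := (- (1 / 2), - (1 / 2)).
Definition p : R2 := (- (Num.sqrt 5 / 2), Num.sqrt 5 / 2).
Definition p' : R2 := (Num.sqrt 5 / 2, - (Num.sqrt 5 / 2)).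

Definition Omega_plus : set R2 :=
  [set q | iter n fR q @[n --> \oo] --> p_plus].
Definition Omega_minus : set R2 :=
  [set q | iter n fR q @[n --> \oo] --> p_minus].

Definition Ws0 : set R2 := [set q | iter n fR q @[n --> \oo] --> orig].
Definition Wu0 : set R2 := [set q | iter n fRinv q @[n --> \oo] --> orig].

(* The library norm on [R * R] is the sup norm. *)
Definition eucl_dist (a b : R2) : R :=
  Num.sqrt ((a.1 - b.1) ^+ 2 + (a.2 - b.2) ^+ 2).
Definition dist_set (q : R2) (A : set R2) : R :=
  inf [set eucl_dist q a | a in A].

Definition Wspp' : set R2 :=
  [set q | dist_set (iter n fR q) [set p; p'] @[n --> \oo] --> (0 : R)].
Definition Wupp' : set R2 :=
  [set q | dist_set (iter n fRinv q) [set p; p'] @[n --> \oo] --> (0 : R)].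

Definition Wu_fsq (a : R2) : set R2 :=
  [set q | iter n (fRinv \o fRinv) q @[n --> \oo] --> a].

Definition Q3 : set R2 :=
  [set q | q.1 <= - (Num.sqrt 5 / 2) /\ Num.sqrt 5 / 2 <= q.2].
Definition Q3' : set R2 := [set q | Q3 (- q)].

Definition unstable_eigenvector (a v : R2) : Prop :=
  v <> 0 /\ exists2 lambda : R, 1 < `|lambda| & 'd (fR \o fR) a v = lambda *: v.

Definition points_into (a v : R2) (Q : set R2) : Prop :=
  forall t : R, 0 < t -> Q° (a + t *: v).

Definition smooth (g : R -> R2) : Prop :=
  forall (n : nat) (t : R), derivable (derive1n n g) t 1.

Definition unstable_param (a : R2) (Q : set R2) (v : R2) (g : R -> R2) : Prop :=
  [/\ unstable_eigenvector a v, points_into a v Q &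
  [/\ smooth g, injective g, range g = Wu_fsq a, g 0 = a & derive1 g 0 = v]].

Definition Wu_neg (g g' : R -> R2) : set R2 :=
  g @` [set t | t < 0] `|` g' @` [set t | t < 0].

End Sets.

Arguments unstable_param {R} a Q v g.
Arguments Wu_neg {R} g g' _.
Arguments real_slice {R} A _.

(* Main.v *)
Require Import Defs.
From mathcomp Require Import all_boot all_order all_algebra.
From mathcomp Require Import complex ring lra zify.
From mathcomp Require Import all_classical all_reals all_analysis.
Import Order.TTheory GRing.Theory Num.Theory numFieldNormedType.Exports.
Local Open Scope classical_set_scope.
Local Open Scope ring_scope.

(** Write a real orbit as a sequence of numbers, f^n(q) = (x_n, x_(n+1)), so that
x_(n+2) = x_n / 2 - x_(n+1)^3 + (3/4) x_(n+1), and let a = sqrt 5 / 2.  The whole real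
dynamics is governed by signs.  If consecutive coordinates never have strictly opposite
signs, the numbers u_n = |x_n| satisfy the same recurrence (here called straight); if
they always have strictly opposite signs, they satisfy the twisted recurrence
u_(n+2) = u_n / 2 + u_(n+1)^3 - (3/4) u_(n+1).  A point with coordinates of opposite
signs is sent to another such point or into the invariant set [box], hence every real
orbit ends in the box, or has alternating signs from some time on
([box_or_mixed_eventually]).

Along both recurrences the quantity s_n = u_(n+1) + u_n / 2 is a Lyapunov function:
s_(n+1) - s_n equals u_(n+1) (u_(n+1)^2 - 5/4) in the twisted case and
u_(n+1) (1/4 - u_(n+1)^2) in the straight case.  When s_n converges, so does u_n, to two
thirds of the same limit, because u_(n+1) = s_n - u_n / 2 is a contraction; running
backwards, a bounded u_n still converges for the same reason.  This is the content of
[lyapunov_forward] and [lyapunov_backward].  Forwards it gives all limits of bounded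
orbits: the sinks for nonzero points of the box, where |u_n - 1/2| takes the place of
u_n, and 0 or the saddle cycle for alternating orbits ([forward_bounded_cvg]).  Backwards
it shows that a bounded backward orbit either stays in the box, and then tends to 0 unless
it is a sink, or is eventually alternating and tends to the saddle cycle, with all moduli
at most a or all moduli at least a ([backward_bounded_cases]).  Points of the first kind
form the closure of the unstable manifold of 0: the sinks lie in that closure because
some nonzero point of the unstable manifold lies in the box and is attracted by a sink;
such a point exists because the images of the diagonal are connected and the box is
compact ([exists_unstable_point]).

On the unstable manifold of the saddle cycle the function -xy - 5/4 vanishes only at p
and p'; elsewhere it is negative if the moduli in the past are at most a, and positive if
they are at least a.  Following it along Gamma, the intermediate value theorem and the
direction of the tangent vector show that the negative parameters give exactly the points
where it is negative ([Wu_negE]).  These have bounded forward orbits, while the points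
where it is positive escape; this yields the real slice of K.

For the Julia sets, an escape estimate bounds every bounded orbit, forwards or backwards,
by max(2, |q|), so that K^+ and K^- are closed, and near an interior point of one of them
all iterates are uniformly bounded.  The Cauchy estimate then bounds the derivatives of
all iterates at such a point ([interior_velocity_bounded]).  This is impossible for
f^(-n), whose Jacobian determinant is (-2)^n, so K^- has empty interior; and it is
impossible for f^n at a point attracted by one of the saddles, where some tangent vector
is expanded.  The basins of the two sinks are interior to K^+, since each sink has an
invariant polydisc around it. *)

(** * Lyapunov sums of real sequences *)

Section Sequences.
Variable R : realType.
Implicit Types (u w d : nat -> R).

Lemma pow2_archimedean (M e : R) : 0 < e -> exists k, M / 2 ^+ k <= e.
Proof.
move=> e0; exists (Num.truncn (M / e)).+1.
have h : M / e < (2 ^ (Num.truncn (M / e)).+1)%:R.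
  by rewrite (lt_trans (truncnS_gt _))// ltr_nat ltn_expl.
by rewrite ler_pdivrMr ?exprn_gt0// mulrC -natrX -ler_pdivrMr// ltW.
Qed.

Lemma halving_cvg0 w d (M : R) : (forall n, 0 <= w n <= M) ->
  d n @[n --> \oo] --> 0 -> (forall n, w n.+1 <= d n + w n / 2) ->
  w n @[n --> \oo] --> 0.
Proof.
move=> wM d0 wd; apply/cvgrPdist_le => e e0.
have [M0 e4] : 0 <= M /\ 0 < e / 4 by have /andP[? ?] := wM 0%N; lra.
have /cvgrPdist_le/(_ _ e4)[N _ dN] := d0.
have bnd k : w (N + k)%N <= e / 2 + M / 2 ^+ k.
  elim: k => [|k IH].
    by rewrite addn0 expr0 divr1; have /andP[_ ?] := wM N; lra.
  have := dN (N + k)%N (leq_addr _ _); rewrite /= sub0r normrN => dk.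
  have := wd (N + k)%N; have {dk} := le_trans (ler_norm _) dk.
  by rewrite addnS exprS invfM mulrCA; lra.
have [k Hk] := @pow2_archimedean M (e / 2) ltac:(lra).
exists (N + k)%N => //= n /= Nkn.
have Nn : (N <= n)%N by rewrite (leq_trans _ Nkn)// leq_addr.
rewrite sub0r normrN ger0_norm; last by have /andP[] := wM n.
have := bnd (n - N)%N; rewrite subnKC// => /le_trans; apply.
suff : M / 2 ^+ (n - N)%N <= M / 2 ^+ k by lra.
by rewrite ler_wpM2l// lef_pV2 ?posrE ?exprn_gt0// ler_weXn2l ?ler1n// leq_subRL.
Qed.

(** Unrolling the inequality k times leaves the term w (n + k) / 2^k, which becomes small
because w is bounded. *)
Lemma backward_halving_cvg0 w d (M : R) : (forall n, 0 <= w n <= M) ->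
  d n @[n --> \oo] --> 0 -> (forall n, w n <= d n + w n.+1 / 2) ->
  w n @[n --> \oo] --> 0.
Proof.
move=> wM d0 wd; apply/cvgrPdist_le => e e0.
have [M0 e4] : 0 <= M /\ 0 < e / 4 by have /andP[? ?] := wM 0%N; lra.
have /cvgrPdist_le/(_ _ e4)[N _ dN] := d0.
have bnd k n : (N <= n)%N -> w n <= e / 2 + M / 2 ^+ k.
  elim: k n => [|k IH] n Nn.
    by rewrite expr0 divr1; have /andP[_ ?] := wM n; lra.
  have := dN n Nn; rewrite /= sub0r normrN => /(le_trans (ler_norm _)).
  by have := wd n; have := IH n.+1 (leqW Nn); rewrite exprS invfM mulrCA; lra.
have [k Hk] := @pow2_archimedean M (e / 2) ltac:(lra).
exists N => //= n /= Nn; have := bnd k n Nn.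
by rewrite sub0r normrN ger0_norm; [lra|have /andP[] := wM n].
Qed.

Lemma dist_cvg0 w (l : R) :
  (`|w n - l| @[n --> \oo] --> 0) <-> (w n @[n --> \oo] --> l).
Proof.
split=> [/norm_cvg0P h|h].
  rewrite (_ : w = fun n => (w n - l) + l); last by apply/funext => n; rewrite subrK.
  by rewrite -[X in _ --> X]add0r; apply: cvgD => //; exact: cvg_cst.
apply/norm_cvg0P; rewrite -(subrr l).
by apply: cvgB => //; exact: cvg_cst.
Qed.

(** The sum determines the sequence up to a contraction: the distance of w to two
thirds of S is halved at each step, up to an error tending to 0. *)
Lemma cvg_of_sum w (M S : R) : (forall n, `|w n| <= M) ->
  w n.+1 + w n / 2 @[n --> \oo] --> S -> w n @[n --> \oo] --> 2 / 3 * S.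
Proof.
move=> wM /dist_cvg0 d0; apply/dist_cvg0.
apply: (@halving_cvg0 _ _ (M + `|2 / 3 * S|) _ d0) => n.
  by rewrite normr_ge0 (le_trans (ler_normB _ _))// lerD2r.
have -> : w n.+1 - 2 / 3 * S = (w n.+1 + w n / 2 - S) - (w n - 2 / 3 * S) / 2.
  by field.
by rewrite (le_trans (ler_normB _ _))// lerD2l normrM (ger0_norm (_ : 0 <= 2^-1)).
Qed.

Lemma cvg_of_backward_sum w (M S : R) : (forall n, `|w n| <= M) ->
  w n + w n.+1 / 2 @[n --> \oo] --> S -> w n @[n --> \oo] --> 2 / 3 * S.
Proof.
move=> wM /dist_cvg0 d0; apply/dist_cvg0.
apply: (@backward_halving_cvg0 _ _ (M + `|2 / 3 * S|) _ d0) => n.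
  by rewrite normr_ge0 (le_trans (ler_normB _ _))// lerD2r.
have -> : w n - 2 / 3 * S = (w n + w n.+1 / 2 - S) - (w n.+1 - 2 / 3 * S) / 2.
  by field.
by rewrite (le_trans (ler_normB _ _))// lerD2l normrM (ger0_norm (_ : 0 <= 2^-1)).
Qed.

(** The sums w_(n+1) + w_n / 2 decrease by at least g(w_(n+1)), so they converge, hence
w converges, and the decrements tend to 0. *)
Lemma lyapunov_forward (g : R -> R) w (M : R) : continuous g ->
  (forall n, `|w n| <= M) ->
  (forall n, 0 <= g (w n.+1) <= (w n.+1 + w n / 2) - (w n.+2 + w n.+1 / 2)) ->
  exists L, [/\ w n @[n --> \oo] --> L, g L = 0 &
                forall n, 3 / 2 * L <= w n.+1 + w n / 2].
Proof.
move=> cg wM wg; pose s n := w n.+1 + w n / 2.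
have s_ni : nonincreasing_seq s.
  apply/nonincreasing_seqP => n; rewrite /s.
  by have /andP[? ?] := wg n; lra.
have cs : cvgn s.
  apply: nonincreasing_is_cvgn => //; exists (- (3 / 2 * M)) => _ [n _ <-].
  have := wM n; have := wM n.+1; rewrite /s !ler_norml; lra.
have wL := @cvg_of_sum w M _ wM cs.
exists (2 / 3 * limn s); split => //; last first.
  by move=> n; have := nonincreasing_cvgn_ge s_ni cs n; rewrite /s; lra.
have gL : g (w n.+1) @[n --> \oo] --> g (2 / 3 * limn s).
  by apply: continuous_cvg; [exact: cg|rewrite (cvg_shiftS w)].
apply/eqP; rewrite eq_le; apply/andP; split.
  have ds : s n - s n.+1 @[n --> \oo] --> limn s - limn s.
    by apply: cvgB => //; rewrite (cvg_shiftS s).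
  rewrite subrr in ds; apply: (ler_cvg_to gL ds).
  by apply: nearW => n; have /andP[] := wg n.
by apply: (cvgr_to_ge gL); apply: nearW => n; have /andP[] := wg n.
Qed.

(** Version for backward orbits: the index counts steps into the past, so that
w_n + w_(n+1) / 2 is the same Lyapunov sum, and it increases with n. *)
Lemma lyapunov_backward (g : R -> R) w (M : R) : continuous g ->
  (forall n, `|w n| <= M) ->
  (forall n, 0 <= g (w n.+1) <= (w n.+1 + w n.+2 / 2) - (w n + w n.+1 / 2)) ->
  exists L, [/\ w n @[n --> \oo] --> L, g L = 0 &
                forall n, w n + w n.+1 / 2 <= 3 / 2 * L].
Proof.
move=> cg wM wg; pose s n := w n + w n.+1 / 2.
have s_nd : nondecreasing_seq s.
  apply/nondecreasing_seqP => n; rewrite /s.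
  by have /andP[? ?] := wg n; lra.
have cs : cvgn s.
  apply: nondecreasing_is_cvgn => //; exists (3 / 2 * M) => _ [n _ <-].
  have := wM n; have := wM n.+1; rewrite /s !ler_norml; lra.
have wL := @cvg_of_backward_sum w M _ wM cs.
exists (2 / 3 * limn s); split => //; last first.
  by move=> n; have := nondecreasing_cvgn_le s_nd cs n; rewrite /s; lra.
have gL : g (w n.+1) @[n --> \oo] --> g (2 / 3 * limn s).
  by apply: continuous_cvg; [exact: cg|rewrite (cvg_shiftS w)].
apply/eqP; rewrite eq_le; apply/andP; split.
  have ds : s n.+1 - s n @[n --> \oo] --> limn s - limn s.
    by apply: cvgB => //; rewrite (cvg_shiftS s).
  rewrite subrr in ds; apply: (ler_cvg_to gL ds).
  by apply: nearW => n; have /andP[] := wg n.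
by apply: (cvgr_to_ge gL); apply: nearW => n; have /andP[] := wg n.
Qed.

(** Every function g to which the Lyapunov lemmas are applied below has this form. *)
Lemma cubic_continuous (a b c d : R) :
  continuous (fun x : R => a + b * x + c * x ^+ 2 + d * x ^+ 3).
Proof.
move=> x; apply: cvgD; [apply: cvgD; [apply: cvgD|]|];
  first exact: cvg_cst.
- by apply: cvgM; [exact: cvg_cst|].
- by apply: cvgM; [exact: cvg_cst|exact: exprn_continuous].
- by apply: cvgM; [exact: cvg_cst|exact: exprn_continuous].
Qed.

End Sequences.

(** * The straight and twisted recurrences *)

Section Recurrences.
Variable R : realType.
Implicit Types (u : nat -> R).

Definition straight (x y z : R) := z = x / 2 - y ^+ 3 + 3 / 4 * y.
Definition twisted (x y z : R) := z = x / 2 + y ^+ 3 - 3 / 4 * y.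

(** The function 3y/4 - y^3 has its maximum 1/4 over the nonnegative numbers at y = 1/2. *)
Lemma straight_le (x y z : R) : straight x y z -> 0 <= y -> z <= x / 2 + 1 / 4.
Proof.
move=> -> y0; have : 0 <= (y - 1 / 2) ^+ 2 * (y + 1) by rewrite mulr_ge0 ?sqr_ge0//; lra.
by rewrite (_ : _ * _ = y ^+ 3 - 3 / 4 * y + 1 / 4); [lra|field].
Qed.

Lemma nonneg_straight_enters u : (forall n, 0 <= u n) ->
  (forall n, straight (u n) (u n.+1) (u n.+2)) ->
  exists n, u n <= 4 / 5 /\ u n.+1 <= 4 / 5.
Proof.
move=> u0 ur; pose M := u 0%N + u 1%N.
have bnd k : u k.*2 <= 1 / 2 + M / 2 ^+ k /\ u k.*2.+1 <= 1 / 2 + M / 2 ^+ k.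
  elim: k => [|k [IH1 IH2]].
    by rewrite expr0 /M divr1; have := u0 0%N; have := u0 1%N; lra.
  rewrite doubleS exprS invfM mulrCA.
  have := straight_le _ _ _ (ur k.*2) (u0 _).
  have := straight_le _ _ _ (ur k.*2.+1) (u0 _).
  by split; lra.
have [k Hk] := @pow2_archimedean _ M (3 / 10) ltac:(lra).
by exists k.*2; have := bnd k; lra.
Qed.

(** Here the Lyapunov sum is taken for the distances w to 1/2.  It decreases by at least
(3/10) w (1/2 - w), so the limit distance is 0 or 1/2; the latter would force both
initial terms to be 0. *)
Lemma straight_box_cvg u : (forall n, 0 <= u n <= 7 / 10) ->
  (forall n, straight (u n) (u n.+1) (u n.+2)) -> 0 < u 0%N + u 1%N ->
  u n @[n --> \oo] --> (1 / 2 : R).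
Proof.
move=> uB ur upos; pose w n := `|u n - 1 / 2|.
have wB n : 0 <= w n <= 1 / 2.
  by rewrite normr_ge0 /w ler_norml; have /andP[] := uB n; lra.
(* The constants make g(x) = (3/10) x (1/2 - x) a lower bound for the decrement. *)
pose g (x : R) := 0 + 3 / 20 * x + (- (3 / 10)) * x ^+ 2 + 0 * x ^+ 3.
have gE x : g x = 3 / 10 * (x * (1 / 2 - x)) by rewrite /g; field.
have wg n : 0 <= g (w n.+1) <= (w n.+1 + w n / 2) - (w n.+2 + w n.+1 / 2).
  have -> : 0 <= g (w n.+1).
    by have /andP[? ?] := wB n.+1; rewrite gE; apply: mulr_ge0; [|apply: mulr_ge0]; lra.
  rewrite gE /=.
  have key : w n.+2 <= w n / 2 + (1 / 2 * w n.+1 - 3 / 10 * (w n.+1 * (1 / 2 - w n.+1))).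
    have -> : w n.+2 = `|(u n - 1 / 2) / 2 + - ((u n.+1 - 1 / 2) ^+ 2 * (u n.+1 + 1))|.
      by rewrite /w (ur n); congr (`|_|); field.
    rewrite (le_trans (ler_normD _ _))// normrM (ger0_norm (_ : 0 <= 2^-1))//.
    rewrite lerD2l normrN ger0_norm; last first.
      by rewrite mulr_ge0 ?sqr_ge0//; have /andP[] := uB n.+1; lra.
    have /andP[y0 y7] := uB n.+1; rewrite /w; move: (u n.+1) y0 y7 => y y0 y7.
    have [yh|yh] := leP (1 / 2) y.
      rewrite -subr_ge0 ger0_norm; last lra.
      rewrite (_ : _ - _ = (y - 1 / 2) * ((7 / 10 - y) * (y + 9 / 10) + 7 / 100)).
        by apply: mulr_ge0; [lra|apply: addr_ge0; [apply: mulr_ge0|]; lra].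
      by field.
    rewrite -subr_ge0 ler0_norm; last lra.
    rewrite (_ : _ - _ = (1 / 2 - y) * (y * (y + 1 / 5))); last by field.
    by apply: mulr_ge0; [lra|apply: mulr_ge0; lra].
  lra.
have wM n : `|w n| <= 1 / 2 by have /andP[? ?] := wB n; rewrite ger0_norm.
have [L [wL gL sL]] := @lyapunov_forward _ g w _ (@cubic_continuous _ _ _ _ _) wM wg.
suff L0 : L = 0 by apply/dist_cvg0; rewrite -L0.
have : L < 1 / 2.
  have := sL 0%N; have /andP[_ h0] := wB 0%N; have /andP[_ h1] := wB 1%N.
  suff : w 0%N + w 1%N < 1 by lra.
  have /andP[a0 a1] := uB 0%N; have /andP[b0 b1] := uB 1%N.
  have [?|?] : u 0%N > 0 \/ u 1%N > 0 by case: (ltP 0 (u 0%N)) => ?; [left|right; lra].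
    suff : w 0%N < 1 / 2 by lra.
    by rewrite /w ltr_norml; lra.
  suff : w 1%N < 1 / 2 by lra.
  by rewrite /w ltr_norml; lra.
move: gL; rewrite gE => gL Lh.
have : L * (1 / 2 - L) = 0 by lra.
by move=> /eqP; rewrite mulf_eq0 => /orP[/eqP//|/eqP]; lra.
Qed.

(** The excess over 1/2 is halved every two steps forward, so a positive excess would
have to double every two steps into the past. *)
Lemma backward_straight_le u (M : R) : (forall n, 0 <= u n <= M) ->
  (forall n, straight (u n.+2) (u n.+1) (u n)) -> forall n, u n <= 1 / 2.
Proof.
move=> uB ur; have bnd k : forall n, u n <= 1 / 2 + M / 2 ^+ k.
  elim: k => [|k IH] n.
    by rewrite expr0 divr1; have /andP[_] := uB n; lra.
  have := straight_le _ _ _ (ur n) (_ : 0 <= u n.+1).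
  have /andP[-> _] := uB n.+1.
  by have := IH n.+2; rewrite exprS invfM mulrCA; lra.
move=> n; apply/ler_addgt0Pr => e e0.
by have [k Hk] := @pow2_archimedean _ M e e0; have := bnd k n; lra.
Qed.

Lemma backward_straight_cvg u (M : R) : (forall n, 0 <= u n <= M) ->
  (forall n, straight (u n.+2) (u n.+1) (u n)) ->
  u n @[n --> \oo] --> 0 \/ u 0%N = 1 / 2 /\ u 1%N = 1 / 2.
Proof.
move=> uB ur; have uh := backward_straight_le _ _ uB ur.
have u0 n : 0 <= u n by have /andP[] := uB n.
pose w n := 1 / 2 - u n.
pose g (x : R) := 0 + 1 / 2 * x + (- (3 / 2)) * x ^+ 2 + 1 * x ^+ 3.
have gE x : g x = x * ((1 / 2 - x) * (1 - x)) by rewrite /g; field.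
have wg n : 0 <= g (w n.+1) <= (w n.+1 + w n.+2 / 2) - (w n + w n.+1 / 2).
  have -> : 0 <= g (w n.+1).
    have ? := uh n.+1; have ? := u0 n.+1; rewrite gE /w.
    by apply: mulr_ge0; [|apply: mulr_ge0]; lra.
  rewrite /g /w (ur n) /=.
  by rewrite le_eqVlt; apply/orP; left; apply/eqP; field.
have wM n : `|w n| <= 1 / 2 by rewrite ler_norml /w; have := uh n; have := u0 n; lra.
have [L [wL gL sL]] := @lyapunov_backward _ g w _ (@cubic_continuous _ _ _ _ _) wM wg.
have uL : u n @[n --> \oo] --> (1 / 2 - L : R).
  rewrite (_ : u = fun n => 1 / 2 - w n).
    by apply: cvgB => //; exact: cvg_cst.
  by apply/funext => n; rewrite /w; lra.
have L1 : L <= 1 / 2.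
  by apply: (cvgr_to_le wL); apply: nearW => n; rewrite /w; have := u0 n; lra.
move: gL; rewrite gE => /eqP; rewrite !mulf_eq0 => /or3P[] /eqP hL.
- right; have := sL 0%N; have := uh 0%N; have := uh 1%N; rewrite /w hL; lra.
- by left; rewrite hL in uL.
- lra.
Qed.


Lemma twisted_low (a : R) (a0 : 0 < a) (a2 : a ^+ 2 = 5 / 4) (x y z : R) :
  twisted x y z -> x <= a -> 0 <= y <= a -> z <= a.
Proof.
move=> -> xa /andP[y0 ya]; have : y ^+ 2 <= a ^+ 2.
  by rewrite ler_sqr ?nnegrE// ltW.
rewrite a2 => y2; have : y * (y ^+ 2 - 3 / 4) <= y * (1 / 2).
  by apply: ler_wpM2l => //; lra.
by rewrite (_ : y * (_ - _) = y ^+ 3 - 3 / 4 * y); [lra|field].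
Qed.

Lemma twisted_high (a : R) (a0 : 0 < a) (a2 : a ^+ 2 = 5 / 4) (x y z : R) :
  twisted x y z -> a <= x -> a <= y -> a <= z.
Proof.
move=> -> xa ya; have y0 : 0 <= y by lra.
have : a ^+ 2 <= y ^+ 2 by rewrite ler_sqr ?nnegrE// ltW.
rewrite a2 => y2; have : y * (1 / 2) <= y * (y ^+ 2 - 3 / 4).
  by apply: ler_wpM2l => //; lra.
by rewrite (_ : y * (_ - _) = y ^+ 3 - 3 / 4 * y); [lra|field].
Qed.

(** Used for sequences that jump across a.  The coefficients are positive, the second at
least 1/2 when a and y are nonnegative, so deviations that keep changing sign shrink
forwards and grow backwards. *)
Lemma twisted_dev (a : R) (a2 : a ^+ 2 = 5 / 4) (x y z : R) : twisted x y z ->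
  z - a = (x - a) / 2 + (y ^+ 2 + y * a + 1 / 2) * (y - a).
Proof.
move=> ->; have h : y * (a ^+ 2 - 5 / 4) = 0 by rewrite a2 subrr mulr0.
by rewrite -[RHS]addr0 -h; field.
Qed.

(** The decrement u (a^2 - u^2) of the Lyapunov sum is nonnegative below a.  If the limit
is a, the sum decreases to its largest possible value 3a/2 and is constant. *)
Lemma twisted_low_cvg (a : R) (a0 : 0 < a) (a2 : a ^+ 2 = 5 / 4) u :
  (forall n, 0 <= u n <= a) ->
  (forall n, twisted (u n) (u n.+1) (u n.+2)) ->
  u n @[n --> \oo] --> 0 \/ u 0%N = a /\ u 1%N = a.
Proof.
move=> uB ur.
pose g (x : R) := 0 + 5 / 4 * x + 0 * x ^+ 2 + (- 1) * x ^+ 3.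
have gE x : g x = x * (a - x) * (a + x). by rewrite /g -a2; field.
have wg n : 0 <= g (u n.+1) <= (u n.+1 + u n / 2) - (u n.+2 + u n.+1 / 2).
  have /andP[? ?] := uB n.+1.
  have -> : 0 <= g (u n.+1) by rewrite gE; do 2?apply: mulr_ge0; lra.
  rewrite /g (ur n) /=.
  by rewrite le_eqVlt; apply/orP; left; apply/eqP; field.
have wM n : `|u n| <= a by have /andP[? ?] := uB n; rewrite ger0_norm.
have [L [wL gL sL]] := @lyapunov_forward _ g u _ (@cubic_continuous _ _ _ _ _) wM wg.
have L1 : 0 <= L by apply: (cvgr_to_ge wL); apply: nearW => n; have /andP[] := uB n.
move: gL; rewrite gE => /eqP; rewrite !mulf_eq0 -orbA => /or3P[] /eqP hL.
- by left; rewrite hL in wL.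
- right; have /andP[? ?] := uB 0%N; have /andP[? ?] := uB 1%N.
  by have := sL 0%N; lra.
- lra.
Qed.

(** Above a the Lyapunov sum increases; a bounded sequence would converge to a, the
smallest value allowed, so the sum cannot increase at all. *)
Lemma twisted_high_bounded (a : R) (a0 : 0 < a) (a2 : a ^+ 2 = 5 / 4) u (M : R) :
  (forall n, a <= u n <= M) ->
  (forall n, twisted (u n) (u n.+1) (u n.+2)) -> u 0%N = a /\ u 1%N = a.
Proof.
move=> uB ur; pose w n := - u n.
pose g (x : R) := 0 + 5 / 4 * x + 0 * x ^+ 2 + (- 1) * x ^+ 3.
have gE x : g x = (- x) * (- x - a) * (a - x). by rewrite /g -a2; field.
have wg n : 0 <= g (w n.+1) <= (w n.+1 + w n / 2) - (w n.+2 + w n.+1 / 2).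
  have /andP[? ?] := uB n.+1.
  have -> : 0 <= g (w n.+1) by rewrite gE /w; do 2?apply: mulr_ge0; lra.
  rewrite /g /w (ur n) /=.
  by rewrite le_eqVlt; apply/orP; left; apply/eqP; field.
have wM n : `|w n| <= M.
  have /andP[? ?] := uB n; rewrite /w normrN ger0_norm//; lra.
have [L [wL gL sL]] := @lyapunov_forward _ g w _ (@cubic_continuous _ _ _ _ _) wM wg.
have L1 : L <= - a.
  by apply: (cvgr_to_le wL); apply: nearW => n; rewrite /w; have /andP[] := uB n; lra.
have /andP[? ?] := uB 0%N; have /andP[? ?] := uB 1%N.
move: gL; rewrite gE => /eqP; rewrite !mulf_eq0 -orbA => /or3P[] /eqP hL; try lra.
by have := sL 0%N; rewrite /w; lra.
Qed.

(** Two consecutive terms on the same side of a stay on that side, and the two previous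
lemmas apply.  Otherwise consecutive terms are always on opposite sides; then the
deviations from a have decreasing Lyapunov sums of their own. *)
Lemma twisted_bounded_cvg (a : R) (a0 : 0 < a) (a2 : a ^+ 2 = 5 / 4) u (M : R) :
  (forall n, 0 < u n <= M) ->
  (forall n, twisted (u n) (u n.+1) (u n.+2)) ->
  u n @[n --> \oo] --> 0 \/ u n @[n --> \oo] --> a.
Proof.
move=> uB ur; have u0 n : 0 < u n by have /andP[] := uB n.
have const_cvg N : u N = a -> u N.+1 = a -> u n @[n --> \oo] --> a.
  move=> h1 h2; rewrite -(cvg_shiftn N).
  have h k : u (k + N)%N = a /\ u (k + N).+1 = a.
    elim: k => [//|k [i1 i2]]; split=> //; rewrite (ur (k + N)%N) i1 i2.
    by rewrite (exprS a 2) a2; field.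
  rewrite (_ : (fun _ => _) = fun=> a); last by apply/funext => k; case: (h k).
  exact: cvg_cst.
have [[N [h1 h2]]|nolow] := pselect (exists n, u n <= a /\ u n.+1 <= a).
  have h k : u (k + N)%N <= a /\ u (k + N).+1 <= a.
    elim: k => [//|k [i1 i2]]; split=> //.
    by apply: twisted_low _ a0 a2 _ _ _ (ur (k + N)%N) i1 _; rewrite i2 ltW.
  have [|||[i1 i2]] := twisted_low_cvg _ a0 a2 (fun k => u (k + N)%N).
  - by move=> n; rewrite (ltW (u0 _)); case: (h n).
  - by move=> n; exact: ur.
  - by rewrite (cvg_shiftn N u); left.
  - by right; exact: const_cvg i1 i2.
have [[N [h1 h2]]|nohigh] := pselect (exists n, a <= u n /\ a <= u n.+1).
  have h k : a <= u (k + N)%N /\ a <= u (k + N).+1.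
    elim: k => [//|k [i1 i2]]; split=> //.
    exact: twisted_high _ a0 a2 _ _ _ (ur (k + N)%N) i1 i2.
  have [||i1 i2] := twisted_high_bounded _ a0 a2 (fun k => u (k + N)%N) M.
  - by move=> n; have [-> _] := h n; have /andP[] := uB (n + N)%N.
  - by move=> n; exact: ur.
  - by right; exact: const_cvg i1 i2.
right; apply/dist_cvg0; pose w n := `|u n - a|.
have opp n : (u n - a) * (u n.+1 - a) < 0.
  rewrite ltNge; apply/negP => h.
  have [h1|h1] := leP (u n) a.
    apply: nolow; exists n; split=> //; rewrite leNgt; apply/negP => h2.
    have : u n - a = 0.
      apply/eqP; rewrite eq_le; apply/andP; split; first lra.
      by rewrite -(pmulr_lge0 _ (_ : 0 < u n.+1 - a)) ?subr_gt0.
    by move=> h3; apply: nohigh; exists n; split; lra.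
  apply: nohigh; exists n; split; first exact: ltW.
  by rewrite -subr_ge0 -(pmulr_rge0 _ (_ : 0 < u n - a)) ?subr_gt0.
pose g (x : R) := 0 + 1 * x + 0 * x ^+ 2 + 0 * x ^+ 3.
have gE x : g x = x by rewrite /g; field.
have wg n : 0 <= g (w n.+1) <= (w n.+1 + w n / 2) - (w n.+2 + w n.+1 / 2).
  rewrite gE normr_ge0 /= /w (twisted_dev _ a2 _ _ _ (ur n)).
  set c := _ + _ + 1 / 2; have c2 : 1 / 2 <= c.
    have := mulr_gt0 (u0 n.+1) a0; have := sqr_ge0 (u n.+1); rewrite /c; lra.
  have o1 := opp n; have o2 := opp n.+1; move: o2.
  rewrite (twisted_dev _ a2 _ _ _ (ur n)) -/c.
  move: o1; set e := u n - a; set e1 := u n.+1 - a => o1 o2.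
  have [p1|p1] := leP 0 e1.
    have e1p : 0 < e1.
      by rewrite lt_neqAle p1 andbT; apply: contraTneq o1 => <-; rewrite mulr0 ltxx.
    have en : e < 0 by rewrite -(pmulr_llt0 _ e1p).
    have e2n : e / 2 + c * e1 < 0 by rewrite -(pmulr_rlt0 _ e1p).
    rewrite (ltr0_norm e2n) (gtr0_norm e1p) (ltr0_norm en).
    have : 1 / 2 * e1 <= c * e1 by rewrite ler_wpM2r.
    lra.
  have en : 0 < e by rewrite -(nmulr_llt0 _ p1).
  have e2n : 0 < e / 2 + c * e1 by rewrite -(nmulr_rlt0 _ p1).
  rewrite (gtr0_norm e2n) (ltr0_norm p1) (gtr0_norm en).
  have : 1 / 2 * - e1 <= c * - e1 by rewrite ler_wpM2r// oppr_ge0 ltW.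
  lra.
have wM n : `|w n| <= M + a.
  rewrite /w normr_id (le_trans (ler_normB _ _))//.
  by have /andP[? ?] := uB n; rewrite !gtr0_norm// lerD2r.
have [L [wL gL _]] := @lyapunov_forward _ g w _ (@cubic_continuous _ _ _ _ _) wM wg.
by rewrite gE in gL; rewrite gL in wL.
Qed.

End Recurrences.

(** Used with n counting steps into the past: a forward invariant condition that holds
arbitrarily far in the past holds always. *)
Lemma always_or_eventually_never (P : nat -> Prop) :
  (forall n, P n.+1 -> P n) ->
  (forall n, P n) \/ exists N, forall n, (N <= n)%N -> ~ P n.
Proof.
move=> Pdec; have [h|/existsNP[N PN]] := pselect (forall n, P n); first by left.
right; exists N => n /subnKC <-; elim: (n - N)%N => [|k IH]; first by rewrite addn0.
by rewrite addnS => /Pdec.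
Qed.

Section BackwardTwisted.
Variable R : realType.
Implicit Types (u : nat -> R).

(** Consecutive terms on opposite sides of a would stay so in the whole past, with
deviations doubling every two steps.  Hence all terms lie on one side of a, and the
Lyapunov sum is monotone. *)
Lemma backward_twisted_cvg (a : R) (a0 : 0 < a) (a2 : a ^+ 2 = 5 / 4) u (M : R) :
  (forall n, 0 < u n <= M) ->
  (forall n, twisted _ (u n.+2) (u n.+1) (u n)) ->
  u n @[n --> \oo] --> a /\ ((forall n, u n <= a) \/ (forall n, a <= u n)).
Proof.
move=> uB ur; have u0 n : 0 < u n by have /andP[] := uB n.
have same_side n : 0 <= (u n - a) * (u n.+1 - a).
  rewrite leNgt; apply/negP => opp.
  pose e k := u (n + k)%N - a.
  have eE k : e k = e k.+2 / 2 + (u (n + k).+1 ^+ 2 + u (n + k).+1 * a + 1 / 2) * e k.+1.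
    by rewrite /e !addnS; apply: twisted_dev.
  have step k : e k * e k.+1 < 0 -> e k.+1 * e k.+2 < 0 /\ 2 * `|e k| <= `|e k.+2|.
    rewrite (eE k) => h; set c := _ + _ + 1 / 2 in h *.
    have c0 : 0 < c.
      have := mulr_gt0 (u0 (n + k).+1) a0; have := sqr_ge0 (u (n + k).+1).
      by rewrite /c; lra.
    have h1 : e k.+1 * e k.+2 / 2 < - (c * (e k.+1 * e k.+1)).
      rewrite -subr_lt0; apply: le_lt_trans h; rewrite le_eqVlt; apply/orP; left.
      by apply/eqP; field.
    have h2 : 0 <= c * (e k.+1 * e k.+1) by rewrite mulr_ge0 ?(ltW c0)// -expr2 sqr_ge0.
    have h3 : e k.+1 * e k.+2 < 0 by lra.
    split=> //; move: h h3; set x := e k.+2; set y := e k.+1 => h h3.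
    have [x0|x0] := leP 0 x.
      have xp : 0 < x.
        by rewrite lt_neqAle x0 andbT; apply: contraTneq h3 => <-; rewrite mulr0 ltxx.
      have yn : y < 0 by rewrite -(pmulr_llt0 _ xp).
      have ep : 0 < x / 2 + c * y by rewrite -(nmulr_llt0 _ yn).
      have := mulr_gt0 c0 (_ : 0 < - y); rewrite mulrN oppr_gt0 => /(_ yn).
      by rewrite !gtr0_norm//; lra.
    have yp : 0 < y by rewrite -(nmulr_llt0 _ x0).
    have en : x / 2 + c * y < 0 by rewrite -(pmulr_llt0 _ yp).
    have := mulr_gt0 c0 yp.
    by rewrite !ltr0_norm//; lra.
  have grow k : e k.*2 * e k.*2.+1 < 0 /\ `|e 0%N| <= `|e k.*2| / 2 ^+ k.
    elim: k => [|k [h1 h2]].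
      by rewrite expr0 divr1 /e addn0 addn1.
    have [h3 h4] := step _ h1; have [h5 _] := step _ h3.
    rewrite doubleS; split=> //; apply: le_trans h2 _.
    rewrite exprS invfM mulrA ler_wpM2r ?invr_ge0 ?exprn_ge0//.
    lra.
  have en0 : 0 < `|e 0%N|.
    by rewrite normr_gt0; apply: contraTneq opp; rewrite /e addn0 => ->; rewrite mul0r ltxx.
  have [k Hk] := @pow2_archimedean _ (M + a) (`|e 0%N| / 2) ltac:(lra).
  have [_ /le_trans/(_ _)] := grow k; move=> /(_ ((M + a) / 2 ^+ k)) h.
  have : `|e 0%N| <= (M + a) / 2 ^+ k.
    apply: h; rewrite ler_wpM2r ?invr_ge0 ?exprn_ge0// (le_trans (ler_normB _ _))//.
    by have /andP[? ?] := uB (n + k.*2)%N; rewrite !gtr0_norm// lerD2r.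
  lra.
have lohi n : (u n <= a /\ u n.+1 <= a) \/ (a <= u n /\ a <= u n.+1).
  have := same_side n.
  case/orP: (le_total (u n) a) => h1; case/orP: (le_total (u n.+1) a) => h2 h.
  - by left.
  - have : (u n - a) * (u n.+1 - a) <= 0 by apply: mulr_le0_ge0; lra.
    move=> h'; have /eqP : (u n - a) * (u n.+1 - a) = 0 by lra.
    by rewrite mulf_eq0 => /orP[] /eqP ?; [right|left]; lra.
  - have : (u n - a) * (u n.+1 - a) <= 0 by apply: mulr_ge0_le0; lra.
    move=> h'; have /eqP : (u n - a) * (u n.+1 - a) = 0 by lra.
    by rewrite mulf_eq0 => /orP[] /eqP ?; [left|right]; lra.
  - by right.
have uM n : `|u n| <= M by have /andP[? ?] := uB n; rewrite gtr0_norm.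
have low_dec n : u n.+1 <= a /\ u n.+2 <= a -> u n <= a /\ u n.+1 <= a.
  move=> [h1 h2]; split=> //; apply: twisted_low _ a0 a2 _ _ _ (ur n) h2 _.
  by rewrite h1 ltW.
have [low|[N nlow]] := always_or_eventually_never _ low_dec.
  have ua n : u n <= a by case: (low n).
  split; last by left.
  pose g (x : R) := 0 + 5 / 4 * x + 0 * x ^+ 2 + (- 1) * x ^+ 3.
  have gE x : g x = x * (a - x) * (a + x) by rewrite /g -a2; field.
  have wg n : 0 <= g (u n.+1) <= (u n.+1 + u n.+2 / 2) - (u n + u n.+1 / 2).
    have ? := ua n.+1; have ? := u0 n.+1.
    have -> : 0 <= g (u n.+1) by rewrite gE; do 2?apply: mulr_ge0; lra.
    rewrite /g (ur n) /=.
    by rewrite le_eqVlt; apply/orP; left; apply/eqP; field.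
  have [L [wL gL sL]] := @lyapunov_backward _ g u _ (@cubic_continuous _ _ _ _ _) uM wg.
  have L0 : 0 < L by have := sL 0%N; have := u0 0%N; have := u0 1%N; lra.
  move: gL; rewrite gE => /eqP; rewrite !mulf_eq0 -orbA => /or3P[] /eqP hL; try lra.
  by have <- : L = a by lra.
have hi k : a <= u (N + k)%N /\ a <= u (N + k).+1.
  by have [h|//] := lohi (N + k)%N; case: (nlow _ (leq_addr k N)).
have hi_dec n : a <= u n.+1 /\ a <= u n.+2 -> a <= u n /\ a <= u n.+1.
  by move=> [h1 h2]; split=> //; exact: twisted_high _ a0 a2 _ _ _ (ur n) h2 h1.
have [high|[N' nhigh]] := always_or_eventually_never _ hi_dec; last first.
  by case: (nhigh (N + N')%N) => //; exact: leq_addl.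
have ua n : a <= u n by case: (high n).
split; last by right.
pose w n := - u n.
pose g (x : R) := 0 + 5 / 4 * x + 0 * x ^+ 2 + (- 1) * x ^+ 3.
have gE x : g x = (- x) * (- x - a) * (a - x) by rewrite /g -a2; field.
have wg n : 0 <= g (w n.+1) <= (w n.+1 + w n.+2 / 2) - (w n + w n.+1 / 2).
  have ? := ua n.+1.
  have -> : 0 <= g (w n.+1) by rewrite gE /w; do 2?apply: mulr_ge0; lra.
  rewrite /g /w (ur n) /=.
  by rewrite le_eqVlt; apply/orP; left; apply/eqP; field.
have wM n : `|w n| <= M by rewrite normrN.
have [L [wL gL sL]] := @lyapunov_backward _ g w _ (@cubic_continuous _ _ _ _ _) wM wg.
have L1 : L <= - a.
  by apply: (cvgr_to_le wL); apply: nearW => n; rewrite /w; have := ua n; lra.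
have La : - L = a.
  by move: gL; rewrite gE => /eqP; rewrite !mulf_eq0 -orbA => /or3P[] /eqP; lra.
rewrite -La (_ : u = fun n => - w n); first exact: cvgN.
by apply/funext => n; rewrite /w opprK.
Qed.
End BackwardTwisted.

(** * Invariant regions of the real plane *)

Section Plane.
Variable R : realType.
Implicit Types (q : R * R).
Local Notation f := (fR R).

Definition box q := [/\ 0 <= q.1 * q.2, q.1 ^+ 2 <= 3 / 4 & q.2 ^+ 2 <= 3 / 4].
(** A zero coordinate counts as not mixed, so that points with a zero coordinate follow
the straight recurrence. *)
Definition mixed q := q.1 * q.2 < 0.

Lemma fR1 q : (f q).1 = q.2. Proof. by []. Qed.
Lemma fR2 q : (f q).2 = q.1 / 2 - q.2 ^+ 3 + 3 / 4 * q.2. Proof. by []. Qed.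

Lemma abs_le_of_sqr (x c : R) : 0 <= c -> x ^+ 2 <= c ^+ 2 -> `|x| <= c.
Proof.
by move=> c0; rewrite -[x ^+ 2]real_normK ?num_real// ler_sqr ?nnegrE.
Qed.

Lemma cubic_le (y : R) : y ^+ 2 <= 3 / 4 -> `|- y ^+ 3 + 3 / 4 * y| <= 1 / 4.
Proof.
move=> y2; have : `|y| <= 1 by apply: abs_le_of_sqr; lra.
rewrite !ler_norml => /andP[y1 y1'].
have h1 : 0 <= (y - 1 / 2) ^+ 2 * (y + 1) by rewrite mulr_ge0 ?sqr_ge0//; lra.
have h2 : 0 <= (y + 1 / 2) ^+ 2 * (1 - y) by rewrite mulr_ge0 ?sqr_ge0//; lra.
have e1 : (y - 1 / 2) ^+ 2 * (y + 1) = y ^+ 3 - 3 / 4 * y + 1 / 4 by field.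
have e2 : (y + 1 / 2) ^+ 2 * (1 - y) = - y ^+ 3 + 3 / 4 * y + 1 / 4 by field.
lra.
Qed.

Lemma box_le q : box q -> `|(f q).2| <= 7 / 10.
Proof.
move=> [_ x2 /cubic_le hy]; rewrite fR2 -addrA (le_trans (ler_normD _ _))//.
have : `|q.1| <= 7 / 8 by apply: abs_le_of_sqr; lra.
by rewrite normrM (ger0_norm (_ : 0 <= 2^-1))//; lra.
Qed.

Lemma cubic_sign q : q.2 * (f q).2 = q.1 * q.2 / 2 + q.2 ^+ 2 * (3 / 4 - q.2 ^+ 2).
Proof. by rewrite fR2; field. Qed.

Lemma box_step q : box q -> box (f q).
Proof.
move=> qb; have := box_le q qb; case: qb => xy x2 y2 z7.
split; rewrite ?fR1//.
  by rewrite cubic_sign addr_ge0// ?divr_ge0// mulr_ge0 ?sqr_ge0//; lra.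
have : `|(f q).2| ^+ 2 <= (7 / 10) ^+ 2 by rewrite ler_sqr ?nnegrE//; lra.
by rewrite real_normK ?num_real//; lra.
Qed.

(** When the sign pattern breaks, q.2 * (f q).2 >= 0 forces q.2^2 <= 3/4, and the two terms
of (f q).2 have opposite signs, which makes it at most 1/4 in modulus. *)
Lemma mixed_step q : mixed q -> mixed (f q) \/ box (f q).
Proof.
rewrite /mixed fR1 => m; case: (ltP (q.2 * (f q).2) 0) => [|yz]; first by left.
right; have := yz; rewrite cubic_sign => h.
have y2 : q.2 ^+ 2 <= 3 / 4.
  rewrite leNgt; apply/negP => h2.
  have : q.2 ^+ 2 * (3 / 4 - q.2 ^+ 2) <= 0 by rewrite mulr_ge0_le0 ?sqr_ge0//; lra.
  lra.
split; rewrite ?fR1//.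
have /cubic_le := y2; rewrite ler_norml => /andP[c1 c2].
suff : `|(f q).2| <= 1 / 4.
  move=> z; have : `|(f q).2| ^+ 2 <= (1 / 4) ^+ 2 by rewrite ler_sqr ?nnegrE//; lra.
  by rewrite real_normK ?num_real//; lra.
have [y0|y0|y0] := ltgtP q.2 0.
- have x0 : 0 < q.1 by rewrite -(nmulr_llt0 _ y0).
  have z0 : (f q).2 <= 0 by rewrite -(nmulr_rge0 _ y0).
  by rewrite ler_norml; move: z0; rewrite fR2; lra.
- have x0 : q.1 < 0 by rewrite -(pmulr_llt0 _ y0).
  have z0 : 0 <= (f q).2 by rewrite -(pmulr_rge0 _ y0).
  by rewrite ler_norml; move: z0; rewrite fR2; lra.
- by move: m; rewrite y0 mulr0 ltxx.
Qed.

Lemma mixed_twisted q : mixed q -> mixed (f q) -> twisted R `|q.1| `|q.2| `|(f q).2|.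
Proof.
rewrite /mixed fR1 /twisted => m1 m2; have [y0|y0|y0] := ltgtP q.2 0.
- have x0 : 0 < q.1 by rewrite -(nmulr_llt0 _ y0).
  have z0 : 0 < (f q).2 by rewrite -(nmulr_rlt0 _ y0).
  by rewrite (gtr0_norm x0) (gtr0_norm z0) (ltr0_norm y0) fR2; field.
- have x0 : q.1 < 0 by rewrite -(pmulr_llt0 _ y0).
  have z0 : (f q).2 < 0 by rewrite -(pmulr_rlt0 _ y0).
  by rewrite (ltr0_norm x0) (ltr0_norm z0) (gtr0_norm y0) fR2; field.
- by move: m1; rewrite y0 mulr0 ltxx.
Qed.

Lemma nonmixed_straight q : ~ mixed q -> ~ mixed (f q) ->
  straight R `|q.1| `|q.2| `|(f q).2|.
Proof.
rewrite /mixed fR1 /straight => /negP; rewrite -leNgt => m1 /negP; rewrite -leNgt => m2.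
have [y0|y0|y0] := ltgtP q.2 0.
- have x0 : q.1 <= 0 by rewrite -(nmulr_lge0 _ y0).
  have z0 : (f q).2 <= 0 by rewrite -(nmulr_rge0 _ y0).
  by rewrite (ler0_norm x0) (ler0_norm z0) (ltr0_norm y0) fR2; field.
- have x0 : 0 <= q.1 by rewrite -(pmulr_lge0 _ y0).
  have z0 : 0 <= (f q).2 by rewrite -(pmulr_rge0 _ y0).
  by rewrite (ger0_norm x0) (ger0_norm z0) (gtr0_norm y0) fR2; field.
- rewrite fR2 y0 normr0 (_ : _ - _ + _ = q.1 / 2); last by field.
  by rewrite normrM (ger0_norm (_ : 0 <= 2^-1))//; field.
Qed.

Local Notation a := (Num.sqrt (5 : R) / 2).

Lemma saddle_coord_gt0 : 0 < a. Proof. by rewrite divr_gt0// sqrtr_gt0. Qed.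
Lemma saddle_coord_sqr : a ^+ 2 = 5 / 4.
Proof. by rewrite expr_div_n sqr_sqrtr//; field. Qed.
Lemma saddle_coord_gt1 : 1 < a.
Proof.
rewrite -(ltr_sqr (_ : 1 \is Num.nneg)) ?nnegrE ?(ltW saddle_coord_gt0)//.
by rewrite saddle_coord_sqr; lra.
Qed.

(** On the unstable manifold of the saddle cycle this is the side of the branch that
stays bounded; forward orbits may leave the alternating regime only through the box. *)
Definition inner q := box q \/ [/\ mixed q, `|q.1| <= a & `|q.2| <= a].
Definition outer q := [/\ mixed q, a <= `|q.1| & a <= `|q.2|].

Lemma box_not_mixed q : box q -> ~ mixed q.
Proof. by move=> [h _ _]; apply/negP; rewrite -leNgt. Qed.

Lemma box_le1 q : box q -> `|q.1| <= 9 / 10 /\ `|q.2| <= 9 / 10.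
Proof. by move=> [_ h1 h2]; split; apply: abs_le_of_sqr; lra. Qed.

Lemma inner_step q : inner q -> inner (f q).
Proof.
move=> [|[m x y]]; first by left; exact: box_step.
have [m'|] := mixed_step _ m; last by left.
right; split=> //.
apply: twisted_low _ saddle_coord_gt0 saddle_coord_sqr _ _ _ _ x _.
  exact: mixed_twisted m m'.
by rewrite normr_ge0.
Qed.

Lemma outer_step q : outer q -> outer (f q).
Proof.
move=> [m x y]; have [m'|b] := mixed_step _ m.
  split=> //; apply: twisted_high _ saddle_coord_gt0 saddle_coord_sqr _ _ _ _ x y.
  exact: mixed_twisted m m'.
by have [] := box_le1 _ b; rewrite fR1; have := saddle_coord_gt1; lra.
Qed.

Lemma inner_le q : inner q -> `|q.1| <= a /\ `|q.2| <= a.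
Proof.
move=> [/box_le1[]|[]//]; have := saddle_coord_gt1; split; lra.
Qed.

End Plane.

(** * Distance to the saddle cycle *)

Section Saddles.
Variable R : realType.
Implicit Types (q : R * R) (h : nat -> R * R).
Local Notation f := (fR R).
Local Notation a := (Num.sqrt (5 : R) / 2).
Local Notation saddles := [set p R; p' R].

Lemma cvg_coordP h (l : R * R) : h n @[n --> \oo] --> l <->
  (h n).1 @[n --> \oo] --> l.1 /\ (h n).2 @[n --> \oo] --> l.2.
Proof.
split=> [hl|[h1 h2]].
  split.
    exact: (cvg_comp _ _ hl (@cvg_fst _ _ (nbhs l.1) (nbhs l.2) _)).
  exact: (cvg_comp _ _ hl (@cvg_snd _ _ (nbhs l.1) (nbhs l.2) _)).
rewrite (_ : h = fun n => ((h n).1, (h n).2)); last first.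
  by apply/funext => n; case: (h n).
rewrite [l]surjective_pairing.
exact: (@cvg_pair _ _ _ _ (nbhs l.1) (nbhs l.2) _ _ _
  (fun n => (h n).1) (fun n => (h n).2) h1 h2).
Qed.

(** The sup-norm closeness to p or p'; it is easier to compute with than the infimum
defining the Euclidean distance to the two points. *)
Definition near_saddle (e : R) q :=
  (`|q.1 + a| <= e /\ `|q.2 - a| <= e) \/ (`|q.1 - a| <= e /\ `|q.2 + a| <= e).

Lemma eucl_dist_ge q c :
  `|q.1 - c.1| <= eucl_dist R q c /\ `|q.2 - c.2| <= eucl_dist R q c.
Proof.
by split; rewrite -sqrtr_sqr /eucl_dist ler_wsqrtr// ?lerDl ?lerDr ?sqr_ge0.
Qed.

Lemma eucl_dist_le q c : eucl_dist R q c <= `|q.1 - c.1| + `|q.2 - c.2|.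
Proof.
rewrite -[leRHS]ger0_norm ?addr_ge0// -sqrtr_sqr /eucl_dist ler_wsqrtr//.
rewrite (sqrrD `|_|) !real_normK ?num_real//.
by rewrite lerD2r lerDl mulrn_wge0// mulr_ge0.
Qed.

Lemma dist_saddles_ge0 q : 0 <= dist_set R q saddles.
Proof.
apply: lb_le_inf.
  by exists (eucl_dist R q (p R)), (p R) => //; left.
by move=> _ [c _ <-]; exact: sqrtr_ge0.
Qed.

Lemma dist_saddles_near q e : dist_set R q saddles <= e -> near_saddle e q.
Proof.
pose m := Num.min (eucl_dist R q (p R)) (eucl_dist R q (p' R)) => qe.
have : m <= e.
  apply: le_trans qe; apply: lb_le_inf.
    by exists (eucl_dist R q (p R)), (p R) => //; left.
  by move=> _ [c [->|->] <-]; rewrite /m ge_min lexx ?orbT.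
rewrite /m ge_min => /orP[] he; [left|right].
- have [] := eucl_dist_ge q (p R); rewrite /= opprK => h1 h2.
  by split; apply: le_trans he.
- have [] := eucl_dist_ge q (p' R); rewrite /= opprK => h1 h2.
  by split; apply: le_trans he.
Qed.

Lemma near_saddle_dist q e : near_saddle e q -> dist_set R q saddles <= 2 * e.
Proof.
have lb : has_lbound [set eucl_dist R q c | c in saddles].
  by exists 0 => _ [c _ <-]; exact: sqrtr_ge0.
move=> [] [h1 h2].
- apply: (@le_trans _ _ (eucl_dist R q (p R))).
    by apply: (inf_lbound lb); exists (p R) => //; left.
  by apply: le_trans (eucl_dist_le _ _) _; rewrite /= opprK; lra.
- apply: (@le_trans _ _ (eucl_dist R q (p' R))).
    by apply: (inf_lbound lb); exists (p' R) => //; right.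
  by apply: le_trans (eucl_dist_le _ _) _; rewrite /= opprK; lra.
Qed.

Lemma dist_saddles_cvg h : dist_set R (h n) saddles @[n --> \oo] --> (0 : R) <->
  forall e, 0 < e -> \forall n \near \oo, near_saddle e (h n).
Proof.
split=> [/cvgrPdist_le hd e e0|hd].
  apply: filterS (hd _ e0) => n; rewrite sub0r normrN ger0_norm ?dist_saddles_ge0//.
  exact: dist_saddles_near.
apply/cvgrPdist_le => e e0; have e2 : 0 < e / 2 by lra.
apply: filterS (hd _ e2) => n /near_saddle_dist.
by rewrite sub0r normrN ger0_norm ?dist_saddles_ge0//; lra.
Qed.

Lemma near_saddle_mixed e q : mixed R q -> `| `|q.1| - a| <= e ->
  `| `|q.2| - a| <= e -> near_saddle e q.
Proof.
rewrite /mixed => m; have [y0|y0|y0] := ltgtP q.2 0;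
  last by move: m; rewrite y0 mulr0 ltxx.
- have x0 : 0 < q.1 by rewrite -(nmulr_llt0 _ y0).
  rewrite (gtr0_norm x0) (ltr0_norm y0) => h1 h2; right; split=> //.
  by rewrite -normrN opprD.
- have x0 : q.1 < 0 by rewrite -(pmulr_llt0 _ y0).
  rewrite (ltr0_norm x0) (gtr0_norm y0) => h1 h2; left; split=> //.
  by rewrite -normrN opprD.
Qed.

Lemma mixed_cvg_saddles h : (\forall n \near \oo, mixed R (h n)) ->
  `|(h n).1| @[n --> \oo] --> a -> `|(h n).2| @[n --> \oo] --> a ->
  dist_set R (h n) saddles @[n --> \oo] --> (0 : R).
Proof.
move=> hm /cvgrPdistC_le h1 /cvgrPdistC_le h2; apply/dist_saddles_cvg => e e0.
near=> n; apply: near_saddle_mixed; near: n => //; [exact: h1|exact: h2].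
Unshelve. all: by end_near. Qed.

Lemma near_saddle_abs e q : near_saddle e q ->
  a - e <= `|q.1| <= a + e /\ a - e <= `|q.2| <= a + e.
Proof.
have a0 := @saddle_coord_gt0 R.
have aux (x : R) : `|x - a| <= e -> a - e <= `|x| <= a + e.
  by have := ler_norm x; rewrite !ler_norml; lra.
have aux' (x : R) : `|x + a| <= e -> a - e <= `|x| <= a + e.
  by rewrite -[`|x|]normrN -(normrN (x + a)) opprD; exact: aux.
by move=> [] [h1 h2]; split; (exact: aux) || (exact: aux').
Qed.
End Saddles.

(** * Forward orbits *)

Section Forward.
Variable R : realType.
Implicit Types (q : R * R) (h : nat -> R * R).
Local Notation f := (fR R).
Local Notation a := (Num.sqrt (5 : R) / 2).
Local Notation saddles := [set p R; p' R].
Local Notation orbit q n := (iter n (fR R) q).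

Definition forward_bounded q := exists M, forall n, `|(orbit q n).1| <= M.

Lemma orbit_snd q n : (orbit q n).2 = (orbit q n.+1).1.
Proof. by rewrite iterS. Qed.

Lemma forward_inv (P : R * R -> Prop) q : (forall q, P q -> P (f q)) ->
  P q -> forall n, P (orbit q n).
Proof. by move=> Pf Pq; elim=> [//|n IH]; rewrite iterS; exact: Pf. Qed.

Lemma orbit_add q m n : orbit q (m + n) = orbit (orbit q n) m.
Proof. by rewrite iterD. Qed.

Lemma fRN q : f (- q) = - f q.
Proof.
by rewrite /fR /henon /=; apply/eqP; rewrite xpair_eqE eqxx/=; apply/eqP; field.
Qed.

Lemma orbitN q n : orbit (- q) n = - orbit q n.
Proof. by elim: n => [//|n IH]; rewrite !iterS IH fRN. Qed.

(** An orbit that is never mixed follows the straight recurrence in moduli, and then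
its terms drop below 4/5, which puts it in the box. *)
Lemma box_or_mixed_eventually q :
  (exists n, box R (orbit q n)) \/
  (exists N, forall n, mixed R (orbit q (n + N))).
Proof.
have [|nobox] := pselect (exists n, box R (orbit q n)); first by left.
right; have [[N mN]|nomix] := pselect (exists N, mixed R (orbit q N)).
  exists N; elim=> [//|n IH]; rewrite addSn iterS.
  by have [//|b] := mixed_step _ _ IH; case: nobox; exists (n + N).+1; rewrite iterS.
have [|N [h1 h2]] :=
    @nonneg_straight_enters R (fun n => `|(orbit q n).1|) (fun n => normr_ge0 _).
  - move=> n; rewrite -!orbit_snd iterS; apply: nonmixed_straight => m.
      by apply: nomix; exists n.
    by apply: nomix; exists n.+1; rewrite iterS.
exfalso; apply: nobox; exists N; split.
- by rewrite leNgt; apply/negP => m; apply: nomix; exists N.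
- rewrite -[_ ^+ 2]real_normK ?num_real//.
  have : `|(orbit q N).1| ^+ 2 <= (4 / 5) ^+ 2 by rewrite ler_sqr ?nnegrE//; lra.
  lra.
- rewrite orbit_snd -[_ ^+ 2]real_normK ?num_real//.
  have : `|(orbit q N.+1).1| ^+ 2 <= (4 / 5) ^+ 2 by rewrite ler_sqr ?nnegrE//; lra.
  lra.
Qed.

Lemma orbit_shift q N (l : R * R) :
  orbit (orbit q N) n @[n --> \oo] --> l <-> orbit q n @[n --> \oo] --> l.
Proof.
rewrite !cvg_coordP -(cvg_shiftn N (fun n => (orbit q n).1)).
rewrite -(cvg_shiftn N (fun n => (orbit q n).2)).
have E g : (fun n => g (orbit q (n + N))) = (fun n => g (orbit (orbit q N) n)) :> (nat -> R).
  by apply/funext => n; rewrite orbit_add.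
by rewrite (E fst) (E snd).
Qed.

Lemma orbit_cvg_of_fst q (l : R) : (orbit q n).1 @[n --> \oo] --> l ->
  orbit q n @[n --> \oo] --> (l, l).
Proof.
move=> h; apply/cvg_coordP; split=> //=.
rewrite (_ : (fun n => (orbit q n).2) = fun n => (orbit q n.+1).1).
  by rewrite (cvg_shiftS (fun n => (orbit q n).1)).
by apply/funext => n; rewrite orbit_snd.
Qed.

Lemma orbit_inj n : injective (fun q => orbit q n).
Proof.
by elim: n => [//|n IH] q r /=; move/(can_inj (@henonK R))/IH.
Qed.

Lemma orbit0 n : orbit 0 n = 0.
Proof.
elim: n => [//|n IH]; rewrite iterS IH /fR /henon /= expr0n /= mul0r mulr0 subr0 addr0.
by [].
Qed.

(** After two steps both coordinates are at most 7/10, the range in which the distance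
to 1/2 has decreasing Lyapunov sums. *)
Lemma nonneg_box_cvg q : box R q -> 0 <= q.1 -> 0 <= q.2 -> q <> 0 ->
  Omega_plus R q.
Proof.
move=> b x0 y0 q0; rewrite /Omega_plus /= -(orbit_shift q 2).
have inv n : [/\ box R (orbit q n), 0 <= (orbit q n).1 & 0 <= (orbit q n).2].
  elim: n => [//|n [b' x y]]; have := box_step _ _ b'; rewrite iterS => -[h1 h2 h3].
  split=> //; move: b' x y; move: (orbit q n) => r [b1 b2 b3] x y.
  rewrite fR2 (_ : _ - _ + _ = r.1 / 2 + r.2 * (3 / 4 - r.2 ^+ 2)); last by field.
  by rewrite addr_ge0 ?divr_ge0// mulr_ge0// subr_ge0.
pose u n := (orbit (orbit q 2) n).1.
have uE n : u n = (orbit q n.+1).2 by rewrite /u -orbit_add addn2 orbit_snd.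
apply: orbit_cvg_of_fst; apply: (@straight_box_cvg R u).
- move=> n; rewrite uE iterS; have [b' x y] := inv n.
  have := box_le _ _ b'; rewrite ler_norml => /andP[_ ->].
  by have [] := inv n.+1; rewrite iterS => _ _ ->.
- by move=> n; rewrite !uE iterS fR2 orbit_snd.
- have [_ x' y'] := inv 2%N; rewrite /u -orbit_snd.
  rewrite lt_neqAle addr_ge0// andbT eq_sym paddr_eq0//.
  apply/negP => /andP[/eqP h1 /eqP h2]; apply: q0; apply: (@orbit_inj 2).
  by rewrite orbit0 [LHS]surjective_pairing h1 h2.
Qed.

Lemma orbitN_cvg q (l : R * R) :
  orbit q n @[n --> \oo] --> l -> orbit (- q) n @[n --> \oo] --> - l.
Proof.
move=> /cvg_coordP[h1 h2]; apply/cvg_coordP; split.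
  rewrite (_ : (fun n => _) = fun n => - (orbit q n).1); first exact: cvgN h1.
  by apply/funext => n; rewrite orbitN.
rewrite (_ : (fun n => _) = fun n => - (orbit q n).2); first exact: cvgN h2.
by apply/funext => n; rewrite orbitN.
Qed.

Lemma Omega_plusN q : Omega_plus R q -> Omega_minus R (- q).
Proof. exact: orbitN_cvg. Qed.

Lemma Omega_minusN q : Omega_minus R q -> Omega_plus R (- q).
Proof.
move=> /orbitN_cvg; rewrite /p_minus /Omega_plus /= /p_plus.
by rewrite -[X in _ --> X]/(- - _, - - _) !opprK.
Qed.

Lemma same_sign (x y : R) : 0 <= x * y -> (0 <= x /\ 0 <= y) \/ (x <= 0 /\ y <= 0).
Proof.
move=> xy; have [y0|y0|y0] := ltgtP y 0.
- by right; split=> //; rewrite -(nmulr_lge0 _ y0).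
- by left; split=> //; rewrite -(pmulr_lge0 _ y0).
- by case/orP: (le_total 0 x) => ?; [left|right].
Qed.

Lemma boxN q : box R q -> box R (- q).
Proof. by move=> [? ? ?]; split; rewrite /= ?mulrNN ?sqrrN. Qed.

Lemma box_cvg q : box R q -> q <> 0 -> Omega_plus R q \/ Omega_minus R q.
Proof.
move=> b q0; have [/same_sign [[x0 y0]|[x0 y0]] _ _] := b.
  by left; exact: nonneg_box_cvg.
right; rewrite -[q]opprK; apply: Omega_plusN; apply: nonneg_box_cvg.
- exact: boxN.
- by rewrite oppr_ge0.
- by rewrite oppr_ge0.
- by move=> /(congr1 -%R); rewrite opprK oppr0.
Qed.

(** Nonzero points of the box tend to the sinks, and 0 is reached only from itself since
f is injective.  An eventually alternating orbit is covered by the twisted recurrence. *)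
Lemma forward_bounded_cvg q : forward_bounded q ->
  [\/ Omega_plus R q, Omega_minus R q, Ws0 R q | Wspp' R q].
Proof.
move=> [M qM]; have [[N b]|[N mN]] := box_or_mixed_eventually q.
  have [q0|q0] := pselect (q = 0).
    apply: Or43; rewrite q0 /Ws0 /= (_ : (fun n => orbit 0 n) = fun=> 0).
      exact: cvg_cst.
    by apply/funext => n; rewrite orbit0.
  have qN0 : orbit q N <> 0.
    by move=> h; apply: q0; apply: (@orbit_inj N); rewrite /= h orbit0.
  have [|] := box_cvg _ b qN0; rewrite /Omega_plus /Omega_minus /= orbit_shift => h.
    exact: Or41.
  exact: Or42.
pose u n := `|(orbit q (n + N)).1|.
have uS n : u n.+1 = `|(orbit q (n + N)).2| by rewrite /u orbit_snd.
have [|||] := @twisted_bounded_cvg R a (@saddle_coord_gt0 R) (@saddle_coord_sqr R) u M.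
- move=> n; rewrite /u qM andbT normr_gt0; apply: contraPneq (mN n) => /eqP.
  by rewrite /mixed => /eqP ->; rewrite mul0r ltxx.
- move=> n; rewrite !uS addSn iterS /u; apply: mixed_twisted; first exact: mN.
  by have := mN n.+1; rewrite addSn iterS.
- rewrite (cvg_shiftn N (fun n => `|(orbit q n).1|)) => /norm_cvg0P h.
  by apply: Or43; exact: (orbit_cvg_of_fst _ _ h).
- move=> h; apply: Or44; rewrite /Wspp' /=.
  rewrite -(cvg_shiftn N (fun n => dist_set R (orbit q n) saddles)).
  apply: mixed_cvg_saddles => //; first by apply: nearW => n; exact: mN.
  rewrite (_ : (fun n => _) = fun n => u n.+1) ?(cvg_shiftS u)//.

Qed.

Lemma cvg_forward_bounded q (l : R * R) :
  orbit q n @[n --> \oo] --> l -> forward_bounded q.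
Proof.
move=> /cvg_coordP[h _]; have /cvg_seq_bounded/pinfty_ex_gt0[M M0 hM] := cvgP _ h.
by exists M => n; exact: hM.
Qed.

Lemma forward_bounded_shift q N : forward_bounded (orbit q N) -> forward_bounded q.
Proof.
elim: N => [//|N IH] [M hM]; apply: IH; exists (`|(orbit q N).1| + M) => -[|n].
  by rewrite lerDl (le_trans _ (hM 0%N)).
by rewrite iterSr -iterS (le_trans (hM n))// lerDr.
Qed.

Lemma Wspp'_near q : Wspp' R q ->
  exists N, forall n, near_saddle R (1 / 10) (orbit q (n + N)).
Proof.
move=> /dist_saddles_cvg/(_ (1 / 10) ltac:(lra))[N _ hN]; exists N => n.
by apply: hN => /=; exact: leq_addl.
Qed.

Lemma Wspp'_bounded q : Wspp' R q -> forward_bounded q.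
Proof.
move=> /Wspp'_near[N hN]; apply: (@forward_bounded_shift _ N); exists (a + 1 / 10) => n.
by rewrite -orbit_add; have [/andP[]] := near_saddle_abs _ _ _ (hN n).
Qed.

Lemma near_saddle_not_box q : near_saddle R (1 / 10) q -> ~ box R q.
Proof.
move=> /near_saddle_abs[_ h] /box_le1[_ h']; move: h; have := @saddle_coord_gt1 R; lra.
Qed.

Lemma box_not_Wspp' q : box R q -> ~ Wspp' R q.
Proof.
move=> b /Wspp'_near[N /(_ 0%N)/near_saddle_not_box]; apply.
exact: forward_inv (@box_step R) b _.
Qed.

Lemma box_Ws0 q : box R q -> Ws0 R q -> q = 0.
Proof.
move=> b /cvg_coordP[s _]; apply: contrapT => q0.
have [/cvg_coordP[h _]|/cvg_coordP[h _]] := box_cvg _ b q0.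
  by have : 1 / 2 = 0 :> R; [exact: norm_cvg_unique h s|lra].
by have : - (1 / 2) = 0 :> R; [exact: norm_cvg_unique h s|lra].
Qed.

Definition saddle_pt q := q = p R \/ q = p' R.

Lemma mixed_abs_saddle q : mixed R q -> `|q.1| = a -> `|q.2| = a -> saddle_pt q.
Proof.
move=> m x y; have : near_saddle R 0 q.
  by apply: near_saddle_mixed => //; rewrite ?x ?y subrr normr0.
rewrite /near_saddle /saddle_pt /p /p'; case: q {m x y} => x y /=.
move=> [] []; rewrite !normr_le0 subr_eq0 addr_eq0 => /eqP h1 /eqP h2.
  by left; rewrite h1 h2.
by right; rewrite h1 h2.
Qed.

(** A bounded outer orbit has constant Lyapunov sum, so it starts on the saddle cycle. *)
Lemma outer_bounded q : outer R q -> forward_bounded q -> saddle_pt q.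
Proof.
move=> o [M hM]; have oo := forward_inv _ _ (@outer_step R) o.
have [||h1 h2] := @twisted_high_bounded R a (@saddle_coord_gt0 R)
    (@saddle_coord_sqr R) (fun n => `|(orbit q n).1|) M.
- by move=> n; rewrite hM andbT; have [] := oo n.
- move=> n; rewrite -!orbit_snd iterS; apply: mixed_twisted; first by have [] := oo n.
  by have [] := oo n.+1; rewrite iterS.
by apply: mixed_abs_saddle; [have [] := o|exact: h1|exact: h2].
Qed.

Lemma inner_bounded q : inner R q -> forward_bounded q.
Proof.
move=> i; exists a => n.
by have [] := inner_le _ _ (forward_inv _ _ (@inner_step R) i n).
Qed.

(** The moduli stay at most a, so convergence to the saddle cycle makes the Lyapunov sum
decrease to its maximum 3a/2: the orbit is constant in modulus.  This excludes
intersections of the bounded branch with the stable manifold of the cycle. *)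
Lemma inner_Wspp' q : inner R q -> Wspp' R q -> saddle_pt q.
Proof.
move=> i s; have ii := forward_inv _ _ (@inner_step R) i.
have [N hN] := Wspp'_near _ s.
have nobox n : ~ box R (orbit q n).
  move=> b; apply: (near_saddle_not_box _ (hN n)); rewrite addnC orbit_add.
  exact: forward_inv (@box_step R) b _.
have m n : mixed R (orbit q n) by have [/nobox|[]] := ii n.
have [||h|[h1 h2]] := @twisted_low_cvg R a (@saddle_coord_gt0 R)
    (@saddle_coord_sqr R) (fun n => `|(orbit q n).1|).
- by move=> n; rewrite normr_ge0 /=; have [] := inner_le _ _ (ii n).
- move=> n; rewrite -!orbit_snd iterS; apply: mixed_twisted; first exact: m.
  by have := m n.+1; rewrite iterS.
- exfalso; have := h; rewrite -(cvg_shiftn N) => h'.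
  have : 1 / 2 <= 0 :> R.
    apply: (cvgr_to_ge h'); apply: nearW => n.
    have [/andP[h1 _] _] := near_saddle_abs _ _ _ (hN n).
    by apply: le_trans h1; have := @saddle_coord_gt1 R; lra.
  lra.
by apply: mixed_abs_saddle; [exact: (m 0%N)|exact: h1|exact: h2].
Qed.
End Forward.

(** * Backward orbits *)

Section Backward.
Variable R : realType.
Implicit Types (q : R * R) (h : nat -> R * R).
Local Notation f := (fR R).
Local Notation a := (Num.sqrt (5 : R) / 2).
Local Notation saddles := [set p R; p' R].
Local Notation back q n := (iter n (fRinv R) q).

Definition backward_bounded q := exists M, forall n, `|(back q n).2| <= M.

Lemma backward_fst q n : (back q n).1 = (back q n.+1).2.
Proof. by []. Qed.

Lemma fR_back q n : f (back q n.+1) = back q n.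
Proof. exact: henon_invK. Qed.

Lemma fR_back_snd q n : (f (back q n.+1)).2 = (back q n).2.
Proof. by rewrite fR_back. Qed.

Lemma backward_inv (P : R * R -> Prop) q : (forall q, P q -> P (f q)) ->
  forall n, P (back q n) -> P q.
Proof.
move=> Pf; elim=> [//|n IH] Pn; apply: IH; rewrite -fR_back; exact: Pf.
Qed.

Lemma backward_add q m n : back q (m + n) = back (back q n) m.
Proof. by rewrite iterD. Qed.

(** Together with the points whose past lies in the box, these points exhaust the bounded
backward orbits; by [Wupp'_history] they form the unstable manifold of the cycle. *)
Definition saddle_history q :=
  [/\ (exists N, forall n, mixed R (back q (n + N))),
      `|(back q n).2| @[n --> \oo] --> a & inner R q \/ outer R q].

Lemma backward_nonmixed_straight q n : ~ mixed R (back q n) -> ~ mixed R (back q n.+1) ->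
  straight R `|(back q n.+2).2| `|(back q n.+1).2| `|(back q n).2|.
Proof.
move=> m0 m1; rewrite -backward_fst -(fR_back_snd q n).
by apply: nonmixed_straight => //; rewrite fR_back.
Qed.

Lemma backward_mixed_twisted q n : mixed R (back q n) -> mixed R (back q n.+1) ->
  twisted R `|(back q n.+2).2| `|(back q n.+1).2| `|(back q n).2|.
Proof.
move=> m0 m1; rewrite -backward_fst -(fR_back_snd q n).
by apply: mixed_twisted => //; rewrite fR_back.
Qed.

Lemma mixed_history q N : backward_bounded q -> (forall n, mixed R (back q (n + N))) ->
  saddle_history q.
Proof.
move=> [M hM] m; pose u n := `|(back q (n + N)).2|.
have [||uc lohi] :=
    @backward_twisted_cvg R a (@saddle_coord_gt0 R) (@saddle_coord_sqr R) u M.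
- move=> n; rewrite /u hM andbT normr_gt0; apply: contraPneq (m n) => /eqP.
  by rewrite /mixed => /eqP ->; rewrite mulr0 ltxx.
- by move=> n; rewrite /u !addSn; apply: backward_mixed_twisted; [|rewrite -addSn].
split; first by exists N.
  by move: uc; rewrite (cvg_shiftn N (fun n => `|(back q n).2|)).
have uE : `|(back q N).1| = u 1%N by rewrite backward_fst.
have m0 : mixed R (back q N) := m 0%N.
case: lohi => lohi; [left|right].
  apply: (@backward_inv _ _ (@inner_step R) N); right; split=> //; first by rewrite uE.
  exact: (lohi 0%N).
apply: (@backward_inv _ _ (@outer_step R) N); split=> //; first by rewrite uE.
exact: (lohi 0%N).
Qed.

Lemma small_not_mixed_box q :
  ~ mixed R q -> `|q.1| <= 4 / 5 -> `|q.2| <= 4 / 5 -> box R q.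
Proof.
move=> m h1 h2; split; first by rewrite leNgt; apply/negP.
- rewrite -[_ ^+ 2]real_normK ?num_real//.
  have : `|q.1| ^+ 2 <= (4 / 5) ^+ 2 by rewrite ler_sqr ?nnegrE//; lra.
  lra.
- rewrite -[_ ^+ 2]real_normK ?num_real//.
  have : `|q.2| ^+ 2 <= (4 / 5) ^+ 2 by rewrite ler_sqr ?nnegrE//; lra.
  lra.
Qed.

(** The whole past lies in the square of half-side 1/2, where the Lyapunov sum of the
straight recurrence is largest exactly at the sinks. *)
Lemma box_history q : (forall n, box R (back q n)) ->
  [\/ Wu0 R q, q = p_plus R | q = p_minus R].
Proof.
move=> b; pose u n := `|(back q n).2|.
have [||h|[h1 h2]] := @backward_straight_cvg R u (9 / 10).
- by move=> n; rewrite /u normr_ge0 /=; have [] := box_le1 _ _ (b n).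
- by move=> n; apply: backward_nonmixed_straight; exact: box_not_mixed.
- apply: Or31; have h' : (back q n).2 @[n --> \oo] --> 0 by apply/norm_cvg0P.
  apply/cvg_coordP; split=> //=.
  rewrite (_ : (fun n => _) = fun n => (back q n.+1).2)//.
  by rewrite (cvg_shiftS (fun n => (back q n).2)).
have {}h2 : `|q.1| = 1 / 2 := h2; have {}h1 : `|q.2| = 1 / 2 := h1.
have [/same_sign [[x0 y0]|[x0 y0]] _ _] : box R q := b 0%N.
  apply: Or32; rewrite ger0_norm// in h1; rewrite ger0_norm// in h2.
  by rewrite [q]surjective_pairing h1 h2.
apply: Or33; rewrite ler0_norm// in h1; rewrite ler0_norm// in h2.
have [e1 e2] : q.1 = - (1 / 2) /\ q.2 = - (1 / 2) by lra.
by rewrite [q]surjective_pairing e1 e2.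
Qed.

(** Let the past leave the box for good.  If it is in the union of the box and the mixed
points arbitrarily far back, it is eventually mixed.  Otherwise it is eventually
straight, and bounded straight pasts lie in the box after all. *)
Lemma backward_bounded_cases q : backward_bounded q ->
  (forall n, box R (back q n)) \/ saddle_history q.
Proof.
move=> bq; have [M hM] := bq.
have bdec n : box R (back q n.+1) -> box R (back q n).
  by move=> b; rewrite -fR_back; exact: box_step.
have [|[N nb]] := always_or_eventually_never _ bdec; [by left|right].
pose E n := mixed R (back q n) \/ box R (back q n).
have Edec n : E n.+1 -> E n.
  rewrite /E -(fR_back q n) => -[m|b]; first exact: mixed_step.
  by right; exact: box_step.
have [e|[N' ne]] := always_or_eventually_never _ Edec.
  apply: (@mixed_history _ N) => // n.
  by have [//|b] := e (n + N)%N; case: (nb _ (leq_addl n N)).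
exfalso; pose u n := `|(back q (n + N')).2|.
have nm n : ~ mixed R (back q (n + N')).
  by move=> m; apply: (ne (n + N')%N (leq_addl _ _)); left.
have us n : u n <= 1 / 2.
  apply: (@backward_straight_le R u M).
    by move=> k; rewrite /u normr_ge0 hM.
  by move=> k; rewrite /u !addSn; apply: backward_nonmixed_straight => //; rewrite -addSn.
apply: (ne N' (leqnn _)); right; apply: small_not_mixed_box; first exact: (nm 0%N).
  by have := us 1%N; rewrite backward_fst /u; lra.
by have := us 0%N; rewrite /u; lra.
Qed.

Lemma cvg_backward_bounded q (l : R * R) :
  back q n @[n --> \oo] --> l -> backward_bounded q.
Proof.
move=> /cvg_coordP[_ h]; have /cvg_seq_bounded/pinfty_ex_gt0[M M0 hM] := cvgP _ h.
by exists M => n; exact: hM.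
Qed.

Lemma backward_bounded_shift q N : backward_bounded (back q N) -> backward_bounded q.
Proof.
elim: N => [//|N IH] [M hM]; apply: IH; exists (`|(back q N).2| + M) => -[|n].
  by rewrite lerDl (le_trans _ (hM 0%N)).
by rewrite iterSr -iterS (le_trans (hM n))// lerDr.
Qed.

Lemma Wu0_box q : Wu0 R q -> forall n, box R (back q n).
Proof.
move=> w; have [//|[_ h _]] := backward_bounded_cases _ (cvg_backward_bounded _ _ w).
have /cvg_coordP[_ /cvg_norm] := w; rewrite /= normr0 => h'.
have : a = 0 by exact: norm_cvg_unique h h'.
by have := @saddle_coord_gt0 R; lra.
Qed.

Lemma box_not_near_saddle_back q N :
  near_saddle R (1 / 10) (back q N) -> ~ forall n, box R (back q n).
Proof. by move=> /near_saddle_not_box h b; exact: h (b N). Qed.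

Lemma Wupp'_history q : Wupp' R q <-> saddle_history q.
Proof.
split=> [/dist_saddles_cvg/(_ (1 / 10) ltac:(lra))[N _ hN]|[[N m] h _]].
  have [||//] := @backward_bounded_cases q.
    apply: (@backward_bounded_shift _ N); exists (a + 1 / 10) => n.
    rewrite -backward_add.
    by have [_ /andP[]] := near_saddle_abs _ _ _ (hN (n + N)%N (leq_addl _ _)).
  by move=> b; have := box_not_near_saddle_back _ _ (hN N (leqnn _)).
apply: mixed_cvg_saddles => //; last first.
  rewrite (_ : (fun n => `|_|) = fun n => `|(back q n.+1).2|)//.
  by rewrite (cvg_shiftS (fun n => `|(back q n).2|)).
by exists N => //= n Nn; rewrite -(subnK Nn); exact: m.
Qed.

Lemma iter_fsq q n : iter n (fRinv R \o fRinv R) q = back q n.*2.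
Proof. by elim: n => [//|n IH]; rewrite iterS IH doubleS. Qed.

Lemma saddle_near0 c : saddle_pt R c -> near_saddle R 0 c.
Proof. by move=> [->|->]; [left|right]; rewrite /= ?opprK ?subrr ?addNr normr0. Qed.

Lemma Wu_fsq_history c q : saddle_pt R c -> Wu_fsq R c q -> saddle_history q.
Proof.
move=> cs; rewrite /Wu_fsq /= => h.
have {}h : back q n.*2 @[n --> \oo] --> c.
  by apply: cvg_trans h; apply: near_eq_cvg; apply: nearW => n; rewrite iter_fsq.
have [h1 h2] := (cvg_coordP _ _ _).1 h.
have [|b|//] := @backward_bounded_cases q.
  have /cvg_seq_bounded/pinfty_ex_gt0[M1 M10 hM1] := cvgP _ h1.
  have /cvg_seq_bounded/pinfty_ex_gt0[M2 M20 hM2] := cvgP _ h2.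
  exists (M1 + M2) => n; rewrite -(odd_double_half n); case: (odd n) => /=.
    by rewrite (le_trans (hM1 n./2 I))// lerDl ltW.
  by rewrite (le_trans (hM2 n./2 I))// lerDr ltW.
exfalso; have /cvgrPdist_le/(_ (1 / 10) ltac:(lra))[N1 _ hN1] := h1.
have /cvgrPdist_le/(_ (1 / 10) ltac:(lra))[N2 _ hN2] := h2.
have := hN1 (maxn N1 N2) (leq_maxl _ _).
have := hN2 (maxn N1 N2) (leq_maxr _ _) => /= k2 k1.
apply: (box_not_near_saddle_back q (maxn N1 N2).*2 _ b).
by move: k1 k2; case: cs => -> /=; rewrite -(normrN (_ - _)) opprB ?opprK => k1;
  rewrite -(normrN (_ - _)) opprB ?opprK => k2; [left|right].
Qed.

Lemma double_cvg : n.*2 @[n --> \oo] --> \oo.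
Proof.
move=> A [N _ hA]; exists N => //= n Nn; apply: hA => /=.
by rewrite -addnn (leq_trans Nn)// leq_addr.
Qed.

(** Along even times the signs of the coordinates are constant, which decides between
p and p'. *)
Lemma saddle_history_fsq q : saddle_history q -> Wu_fsq R (p R) q \/ Wu_fsq R (p' R) q.
Proof.
move=> [[N m] h _].
have h2 : `|(back q n.*2).2| @[n --> \oo] --> a.
  exact: cvg_comp double_cvg h.
have h1 : `|(back q n.*2).1| @[n --> \oo] --> a.
  rewrite -(cvg_shiftS (fun n => `|(back q n).2|)) in h.
  exact: cvg_comp double_cvg h.
have h1N : - `|(back q n.*2).1| @[n --> \oo] --> - a by exact: cvgN h1.
have h2N : - `|(back q n.*2).2| @[n --> \oo] --> - a by exact: cvgN h2.
have alt n : (N <= n)%N -> (back q n.+1).2 * (back q n).2 < 0.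
  by move=> Nn; have := m (n - N)%N; rewrite subnK.
have sgn2 n : (N <= n)%N -> 0 < (back q n.+2).2 * (back q n).2.
  move=> Nn; have a1 := alt n Nn; have a2 := alt n.+1 (leqW Nn).
  have [y0|y0|y0] := ltgtP (back q n.+1).2 0.
  - by rewrite mulr_gt0// -(nmulr_rlt0 _ y0)// mulrC.
  - by rewrite nmulr_rgt0 -(pmulr_rlt0 _ y0)// mulrC.
  - by move: a1; rewrite y0 mul0r ltxx.
pose s := (back q N.*2).2.
have N2 : (N <= N.*2)%N by rewrite -addnn leq_addr.
have sgn k : 0 < (back q (N + k).*2).2 * s.
  elim: k => [|k IH].
    rewrite addn0 lt_neqAle -expr2 sqr_ge0 andbT eq_sym sqrf_eq0.
    by apply: contraTneq (alt _ N2) => ->; rewrite mulr0 ltxx.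
  rewrite addnS doubleS; have /sgn2 : (N <= (N + k).*2)%N.
    by rewrite (leq_trans N2)// leq_double leq_addr.
  move: IH; set y := (_ _).2; set z := (_ _).2 => ys zy.
  have [s0|s0|s0] := ltgtP s 0; last by move: ys; rewrite s0 mulr0 ltxx.
  - by rewrite nmulr_lgt0// -(nmulr_lgt0 _ (_ : y < 0))// -(nmulr_lgt0 _ s0).
  - by rewrite pmulr_lgt0// -(pmulr_lgt0 _ (_ : 0 < y))// -(pmulr_lgt0 _ s0).
have sgn' n : (N <= n)%N -> 0 < (back q n.*2).2 * s by move=> /subnKC <-.
have opp n : (N <= n)%N -> (back q n.*2).1 * (back q n.*2).2 < 0.
  move=> Nn; have := alt n.*2; rewrite -backward_fst; apply.
  by rewrite (leq_trans Nn)// -addnn leq_addr.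
have fsq c : back q n.*2 @[n --> \oo] --> c -> Wu_fsq R c q.
  move=> hc; apply: cvg_trans hc; apply: near_eq_cvg.
  by apply: nearW => n; rewrite iter_fsq.
have [s0|s0] := leP s 0; [right|left]; apply: fsq; apply/cvg_coordP; split=> /=.
- apply: cvg_trans h1; apply: near_eq_cvg; exists N => //= n Nn.
  have y0 : (back q n.*2).2 < 0.
    rewrite ltNge; apply: contraTN (sgn' _ Nn) => y0.
    by rewrite -leNgt mulr_ge0_le0.
  by rewrite gtr0_norm// -(nmulr_llt0 _ y0) opp.
- apply: cvg_trans h2N; apply: near_eq_cvg; exists N => //= n Nn.
  have y0 : (back q n.*2).2 < 0.
    rewrite ltNge; apply: contraTN (sgn' _ Nn) => y0.
    by rewrite -leNgt mulr_ge0_le0.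
  by rewrite ltr0_norm// opprK.
- apply: cvg_trans h1N; apply: near_eq_cvg; exists N => //= n Nn.
  have y0 : 0 < (back q n.*2).2 by rewrite -(pmulr_lgt0 _ s0) sgn'.
  by rewrite ltr0_norm ?opprK// -(pmulr_llt0 _ y0) opp.
- apply: cvg_trans h2; apply: near_eq_cvg; exists N => //= n Nn.
  have y0 : 0 < (back q n.*2).2 by rewrite -(pmulr_lgt0 _ s0) sgn'.
  by rewrite gtr0_norm.
Qed.
End Backward.

(** * The closure of the unstable manifold of the origin *)

Section Continuity.
Variable F : numFieldType.

Lemma henon_continuous : continuous (henon F : F^o * F^o -> F^o * F^o).
Proof.
move=> q; have h1 : fst @ nbhs q --> (q.1 : F^o) by exact: cvg_fst.
have h2 : snd @ nbhs q --> (q.2 : F^o) by exact: cvg_snd.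
apply: (@cvg_pair _ _ _ (nbhs q) (nbhs (q.2 : F^o)) (nbhs ((henon F q).2 : F^o))) => //.
apply: cvgD; [apply: cvgB|].
- by apply: cvgM => //; exact: cvg_cst.
- exact: (cvgM h2 (cvgM h2 h2)).
- by apply: cvgM => //; exact: cvg_cst.
Qed.

Lemma henon_inv_continuous : continuous (henon_inv F : F^o * F^o -> F^o * F^o).
Proof.
move=> q; have h1 : fst @ nbhs q --> (q.1 : F^o) by exact: cvg_fst.
have h2 : snd @ nbhs q --> (q.2 : F^o) by exact: cvg_snd.
apply: (@cvg_pair _ _ _ (nbhs q) (nbhs ((henon_inv F q).1 : F^o)) (nbhs (q.1 : F^o))) => //.
apply: cvgD; [apply: cvgB|].
- apply: cvgM; first exact: cvg_cst.
  exact: (cvgM h1 (cvgM h1 h1)).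
- by apply: cvgM => //; exact: cvg_cst.
- by apply: cvgM => //; exact: cvg_cst.
Qed.

End Continuity.

Lemma iter_continuous (T : topologicalType) (g : T -> T) n :
  continuous g -> continuous (iter n g).
Proof.
move=> cg; elim: n => [|n IH] x; first exact: cvg_id.
by apply: continuous_comp; [exact: IH|exact: cg].
Qed.

Section UnstableOrigin.
Variable R : realType.
Implicit Types (q : R * R) (h : nat -> R * R).
Local Notation f := (fR R).
Local Notation a := (Num.sqrt (5 : R) / 2).
Local Notation orbit q n := (iter n (fR R) q).
Local Notation back q n := (iter n (fRinv R) q).

Lemma orbit_continuous n : continuous (fun q => orbit q n).
Proof. apply: iter_continuous; exact: (@henon_continuous R). Qed.

Lemma backward_continuous n : continuous (fun q => back q n).
Proof. apply: iter_continuous; exact: (@henon_inv_continuous R). Qed.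

Lemma fst_continuous : continuous (fst : R * R -> R).
Proof. by move=> q; exact: cvg_fst. Qed.

Lemma snd_continuous : continuous (snd : R * R -> R).
Proof. by move=> q; exact: cvg_snd. Qed.

Lemma closed_preimage (T U : topologicalType) (g : T -> U) (A : set U) :
  continuous g -> closed A -> closed (g @^-1` A).
Proof. by move=> cg; apply: closed_comp => x _; exact: cg. Qed.

Lemma closed_box : closed (box R).
Proof.
rewrite (_ : (box R : set _) =
    (fun q => q.1 * q.2) @^-1` [set x | 0 <= x] `&`
    ((fun q => q.1 ^+ 2) @^-1` [set x | x <= 3 / 4] `&`
     (fun q => q.2 ^+ 2) @^-1` [set x | x <= 3 / 4])); last first.
  by apply/seteqP; split => q /=; [case|move=> [? []]].
apply: closedI; [|apply: closedI]; apply: closed_preimage.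
- by move=> q; apply: cvgM; [exact: fst_continuous|exact: snd_continuous].
- exact: closed_ge.
- by move=> q; apply: cvgM; exact: fst_continuous.
- exact: closed_le.
- by move=> q; apply: cvgM; exact: snd_continuous.
- exact: closed_le.
Qed.

Definition small_square q := 0 <= q.1 <= 1 / 2 /\ 0 <= q.2 <= 1 / 2.

Lemma small_square_step q : small_square q -> small_square (f q).
Proof.
move=> [/andP[x0 x1] /andP[y0 y1]]; split; first by rewrite fR1 y0.
have := @straight_le R q.1 q.2 _ erefl y0.
rewrite fR2 => h; apply/andP; split; last lra.
have : 0 <= q.2 * ((1 / 2 - q.2) * (q.2 + 1 / 2)).
  by rewrite mulr_ge0// mulr_ge0; lra.
rewrite (_ : _ * _ = q.2 / 4 - q.2 ^+ 3); last by field.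
lra.
Qed.

Lemma small_square_box q : small_square q -> box R q.
Proof.
move=> [/andP[x0 x1] /andP[y0 y1]]; have h : 1 / 2 * (1 / 2) <= 3 / 4 :> R by lra.
by split; rewrite ?mulr_ge0// expr2 (le_trans _ h)// ler_pM.
Qed.

Lemma closed_small_square : closed small_square.
Proof.
rewrite (_ : (small_square : set _) =
    (fst @^-1` [set x | 0 <= x] `&` fst @^-1` [set x | x <= 1 / 2]) `&`
    (snd @^-1` [set x | 0 <= x] `&` snd @^-1` [set x | x <= 1 / 2])); last first.
  apply/seteqP; split => q /=; first by move=> [/andP[? ?] /andP[? ?]].
  by move=> [[x0 x1] [y0 y1]]; split; apply/andP.
by apply: closedI; apply: closedI; apply: closed_preimage;
  (exact: fst_continuous || exact: snd_continuous || exact: closed_ge || exact: closed_le).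
Qed.

Lemma compact_small_square : compact small_square.
Proof.
rewrite (_ : (small_square : set _) = `[0, 1 / 2]%classic `*` `[0, 1 / 2]%classic).
  by apply: compact_setX; exact: segment_compact.
by apply/seteqP; split => q /=; rewrite !in_itv.
Qed.

(** The Lyapunov sum of the straight recurrence; its values at 0 and at the positive sink
are 0 and 3/4. *)
Definition height q : R := q.2 + q.1 / 2.

Lemma height_continuous : continuous height.
Proof.
move=> q; apply: cvgD; first exact: snd_continuous.
by apply: cvgM; [exact: fst_continuous|exact: cvg_cst].
Qed.

(** The segment from 0 to the positive sink is mapped by f^n to an arc with the same end
points, which crosses every intermediate height. *)
Lemma diagonal_height n :
  exists2 t : R, 0 <= t <= 1 / 2 & height (orbit (t, t) n) = 3 / 8.
Proof.
pose g (t : R) := height (orbit (t, t) n).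
have cg : continuous g.
  move=> t; apply: (@continuous_comp R (R * R)%type R (fun t => orbit (t, t) n) height t).
    apply: (@continuous_comp R (R * R)%type (R * R)%type
      (fun t : R => (t, t)) (fun q => orbit q n) t).
      by apply: (@cvg_pair _ _ _ (nbhs t) (nbhs t) (nbhs t)).
    exact: orbit_continuous.
  exact: height_continuous.
have g0 : g 0 = 0.
  by rewrite /g (_ : (0, 0) = 0 :> R * R)// orbit0 /height /= mul0r addr0.
have g1 : g (1 / 2) = 3 / 4.
  have -> : g (1 / 2) = height (1 / 2, 1 / 2).
    rewrite /g; congr height; elim: n {g cg g0} => [//|n IH]; rewrite iterS IH.
    by rewrite /fR /henon /=; congr pair; field.
  by rewrite /height /=; field.
have [|||t] := @IVT R g 0 (1 / 2) (3 / 8).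
- lra.
- exact: continuous_subspaceT.
- by rewrite g0 g1 /Num.min /Num.max; case: ifP => ?; lra.
by rewrite in_itv /= => ? ?; exists t.
Qed.

Lemma backward_orbit q n k : (k <= n)%N -> back (orbit q n) k = orbit q (n - k).
Proof.
elim: k n => [|k IH] [|n] //; rewrite ltnS subSS => kn.
by rewrite iterSr iterS (henonK R : cancel f (fRinv R)) IH.
Qed.

Lemma backwardN q n : back (- q) n = - back q n.
Proof.
elim: n => [//|n IH]; rewrite !iterS IH; case: (back q n) => x y.
by rewrite /fRinv /henon_inv /=; congr pair; rewrite /=; field.
Qed.

(** Points of height 3/8 on the images of the diagonal have arbitrarily long pasts in the
small square; a cluster point has its whole past there, and its height tells it apart
from 0 and the sinks. *)
Lemma exists_unstable_point :
  exists r, [/\ Wu0 R r, box R r & r <> 0].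
Proof.
have /choice[t ht] : forall n, exists t : R,
    0 <= t <= 1 / 2 /\ height (orbit (t, t) n) = 3 / 8.
  by move=> n; have [t h1 h2] := diagonal_height n; exists t.
pose w n := orbit (t n, t n) n.
have wk n k : (k <= n)%N -> small_square (back (w n) k).
  move=> kn; rewrite /w backward_orbit//.
  by apply: (forward_inv _ _ _ small_square_step); split; have [] := ht n.
have [|r [_ rc]] := @compact_small_square (w @ \oo) _.
  by exists 0%N => // n _; exact: (wk n 0%N).
have rclosed (A : set (R * R)) : closed A -> (\forall n \near \oo, A (w n)) -> A r.
  by move=> cA wA; apply: cA => B nB; have := rc A B wA nB.
have sq k : small_square (back r k).
  apply: (rclosed ((fun q => back q k) @^-1` small_square)).
    by apply: closed_preimage; [exact: backward_continuous|exact: closed_small_square].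
  by exists k => // n; exact: wk.
have hr : height r = 3 / 8.
  apply: (rclosed (height @^-1` [set x | x = 3 / 8])).
    by apply: closed_preimage; [exact: height_continuous|exact: closed_eq].
  by exists 0%N => // n _; have [] := ht n.
exists r; split.
- have [//|e|e] := @box_history R r (fun n => small_square_box _ (sq n));
    move: hr; rewrite e /height /=; lra.
- exact: small_square_box (sq 0%N).
- by move=> e; move: hr; rewrite e /height /=; lra.
Qed.

Lemma Wu0_orbit q n : Wu0 R q -> Wu0 R (orbit q n).
Proof.
move=> /cvg_coordP[h1 h2]; apply/cvg_coordP.
rewrite -(cvg_shiftn n (fun k => (back (orbit q n) k).1)).
rewrite -(cvg_shiftn n (fun k => (back (orbit q n) k).2)).
have E (g : R * R -> R) : (fun k => g (back (orbit q n) (k + n))) = (fun k => g (back q k)).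
  by apply/funext => k; rewrite backward_add backward_orbit// subnn.
by rewrite (E fst) (E snd).
Qed.

Lemma Wu0N q : Wu0 R q -> Wu0 R (- q).
Proof.
move=> /cvg_coordP[/cvgN h1 /cvgN h2]; apply/cvg_coordP; rewrite /= oppr0 in h1 h2 *.
have E (g : {additive (R * R)%type -> R}) :
  (fun n => g (back (- q) n)) = (fun n => - g (back q n)).
  by apply/funext => n; rewrite backwardN raddfN.
by split; [rewrite (E fst)|rewrite (E snd)].
Qed.

Lemma cvg_closure (A : set (R * R)) (h : nat -> R * R) (l : R * R) :
  (forall n, A (h n)) -> h n @[n --> \oo] --> l -> closure A l.
Proof.
move=> Ah hl B /hl[N _ hB]; exists (h N); split; first exact: Ah.
exact: hB (leqnn N).
Qed.

Lemma sinks_closure : closure (Wu0 R) (p_plus R) /\ closure (Wu0 R) (p_minus R).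
Proof.
have [r [wr br r0]] := exists_unstable_point.
have clp s : Wu0 R s -> Omega_plus R s -> closure (Wu0 R) (p_plus R).
  by move=> ws; apply: cvg_closure => n; exact: Wu0_orbit.
have clm s : Wu0 R s -> Omega_minus R s -> closure (Wu0 R) (p_minus R).
  by move=> ws; apply: cvg_closure => n; exact: Wu0_orbit.
have [rp|rm] := box_cvg _ _ br r0.
  split; first exact: clp wr rp.
  by apply: (clm _ (Wu0N _ wr)); exact: Omega_plusN.
split; last exact: clm wr rm.
by apply: (clp _ (Wu0N _ wr)); exact: Omega_minusN.
Qed.

Lemma closure_Wu0 : closure (Wu0 R) = [set q | forall n, box R (back q n)].
Proof.
apply/seteqP; split => q.
  move=> cq n; apply: contrapT => nb.
  have cl : closed ((fun q => back q n) @^-1` box R).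
    by apply: closed_preimage; [exact: backward_continuous|exact: closed_box].
  apply: nb; apply: cl; apply: closure_subset cq => r /Wu0_box; exact.
move=> /box_history[w|->|->]; first exact: subset_closure.
  by case: sinks_closure.
by case: sinks_closure.
Qed.
End UnstableOrigin.

(** * The branches of the unstable manifolds of the saddle cycle *)

Section Branches.
Variable R : realType.
Implicit Types (q c v : R * R) (g : R -> R * R).
Local Notation f := (fR R).
Local Notation a := (Num.sqrt (5 : R) / 2).

(** On mixed points this is |x| |y| - a^2.  Unlike the moduli it is smooth, and it treats
p and p' alike. *)
Definition branch_sign q : R := - (q.1 * q.2) - 5 / 4.

Lemma branch_sign_mixed q : mixed R q -> branch_sign q = `|q.1| * `|q.2| - a ^+ 2.
Proof. by move=> m; rewrite -normrM ltr0_norm// saddle_coord_sqr. Qed.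

Lemma branch_sign_inner q : inner R q -> branch_sign q <= 0.
Proof.
move=> [[xy _ _]|[m x y]]; first by rewrite /branch_sign; lra.
by rewrite branch_sign_mixed// subr_le0 expr2 ler_pM.
Qed.

Lemma branch_sign_outer q : outer R q -> 0 <= branch_sign q.
Proof.
by move=> [m x y]; rewrite branch_sign_mixed// subr_ge0 expr2 ler_pM// ltW// saddle_coord_gt0.
Qed.

Lemma branch_sign_eq0 q : inner R q \/ outer R q -> branch_sign q = 0 -> saddle_pt R q.
Proof.
have a0 := @saddle_coord_gt0 R; move=> [[[xy _ _]|[m x y]]|[m x y]].
- by rewrite /branch_sign; lra.
- rewrite branch_sign_mixed// => /eqP; rewrite subr_eq0 expr2 => /eqP e.
  apply: mixed_abs_saddle => //; apply/eqP; rewrite eq_le ?x ?y /=.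
    rewrite -(ler_pM2r a0) -e; exact: ler_wpM2l.
  rewrite -(ler_pM2l a0) -e; exact: ler_wpM2r.
- rewrite branch_sign_mixed// => /eqP; rewrite subr_eq0 expr2 => /eqP e.
  apply: mixed_abs_saddle => //; apply/eqP; rewrite eq_le ?x ?y ?andbT /=.
    rewrite -(ler_pM2r a0) -e; exact: ler_wpM2l.
  rewrite -(ler_pM2l a0) -e; exact: ler_wpM2r.
Qed.

Lemma branch_sign_saddle c : saddle_pt R c -> branch_sign c = 0.
Proof.
have := @saddle_coord_sqr R; rewrite expr2 => a2.
by move=> [->|->]; rewrite /branch_sign /= ?mulrN ?mulNr opprK a2 subrr.
Qed.

Lemma branch_sign_continuous : continuous branch_sign.
Proof.
move=> q; apply: cvgB; last exact: cvg_cst.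
by apply: cvgN; apply: cvgM; [exact: fst_continuous|exact: snd_continuous].
Qed.

Lemma fRinv_saddle : fRinv R (p R) = p' R /\ fRinv R (p' R) = p R.
Proof.
have := @saddle_coord_sqr R; rewrite /fRinv /henon_inv /p /p' /=; set b := a => b2.
have b3 : b ^+ 3 = 5 / 4 * b by rewrite exprSr b2.
have b3' : (- b) ^+ 3 = - (5 / 4 * b) by rewrite -b3; ring.
by split; congr pair; rewrite ?b3' ?b3 ?opprK//; field.
Qed.

(** Both saddles are fixed by the second iterate, so neither is in the unstable manifold
of the other. *)
Lemma saddle_fsq_unique c c' : saddle_pt R c -> saddle_pt R c' ->
  Wu_fsq R c c' -> c' = c.
Proof.
move=> cs cs'; rewrite /Wu_fsq /= => h.
have fx n : iter n (fRinv R \o fRinv R) c' = c'.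
  by elim: n => [//|n IH]; rewrite iterS IH /=; have [e1 e2] := fRinv_saddle;
    case: cs' => ->; rewrite ?e1 ?e2 ?e1.
have /cvg_coordP[h1 h2] := h.
have k1 : c'.1 = c.1.
  apply: norm_cvg_unique h1; rewrite (_ : (fun n => _) = fun=> c'.1); first exact: cvg_cst.
  by apply/funext => n; rewrite fx.
have k2 : c'.2 = c.2.
  apply: norm_cvg_unique h2; rewrite (_ : (fun n => _) = fun=> c'.2); first exact: cvg_cst.
  by apply/funext => n; rewrite fx.
by rewrite [c']surjective_pairing k1 k2 -surjective_pairing.
Qed.

Lemma interior_shift (A : set (R * R)) q : A° q ->
  exists2 e, 0 < e & [/\ A (q.1 + e, q.2), A (q.1 - e, q.2),
                         A (q.1, q.2 + e) & A (q.1, q.2 - e)].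
Proof.
move=> /nbhs_ballP[r /= r0 rA]; exists (r / 2); first by rewrite divr_gt0.
have r2 : 0 < r / 2 by rewrite divr_gt0.
have rr : r / 2 < r by lra.
split; apply: rA; split; rewrite /ball /= ?opprD ?addrA ?subrr ?sub0r ?opprK;
  by rewrite ?add0r ?normrN ?normr0 ?gtr0_norm.
Qed.

Lemma points_into_Q3 v : points_into R (p R) v (Q3 R) -> v.1 < 0 /\ 0 < v.2.
Proof.
move=> /(_ 1 ltr01)/interior_shift[e e0 []]; rewrite /Q3 /= !scale1r /=.
by move=> [h1 _] _ _ [_ h2]; split; lra.
Qed.

Lemma points_into_Q3' v : points_into R (p' R) v (Q3' R) -> 0 < v.1 /\ v.2 < 0.
Proof.
move=> /(_ 1 ltr01)/interior_shift[e e0 []]; rewrite /Q3' /Q3 /= !scale1r /=.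
by move=> _ [h1 _] [_ h2] _; split; lra.
Qed.

Lemma branch_sign_derivative g v :
  derivable g 0 1 -> derive1 g 0 = v -> branch_sign (g 0) = 0 ->
  h^-1 * branch_sign (g h) @[h --> 0^'] --> - (v.1 * (g 0).2 + (g 0).1 * v.2).
Proof.
move=> dg gv g0.
have D : h^-1 *: (g h - g 0) @[h --> 0^'] --> v.
  rewrite -gv derive1E (_ : (fun h => _) =
      fun h => h^-1 *: ((g \o shift 0) (h *: (1 : R)) - g 0)).
    exact: dg.
  by apply/funext => h; rewrite /= addr0 -[h *: _]/(h * 1) mulr1.
have cg : g h @[h --> 0^'] --> g 0.
  apply: cvg_within_filter; apply: differentiable_continuous; exact/derivable1_diffP.
have D1 : h^-1 * ((g h).1 - (g 0).1) @[h --> 0^'] --> v.1.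
  exact: (cvg_comp _ _ D (@fst_continuous R _)).
have D2 : h^-1 * ((g h).2 - (g 0).2) @[h --> 0^'] --> v.2.
  exact: (cvg_comp _ _ D (@snd_continuous R _)).
have c2 : (g h).2 @[h --> 0^'] --> (g 0).2.
  exact: (cvg_comp _ _ cg (@snd_continuous R _)).
rewrite (_ : (fun h => _) = fun h => - (h^-1 * ((g h).1 - (g 0).1) * (g h).2 +
                       (g 0).1 * (h^-1 * ((g h).2 - (g 0).2)))).
  by apply: cvgN; apply: cvgD; apply: cvgM => //; exact: cvg_cst.
apply/funext => h; move: g0; rewrite /branch_sign => g0.
have -> : 5 / 4 = - ((g 0).1 * (g 0).2) by lra.
ring.
Qed.

(** Along g the function [branch_sign] vanishes only at g 0 by injectivity, and its
derivative at 0 is positive; the intermediate value theorem propagates the signs. *)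
Lemma branch_signs c v g : saddle_pt R c -> injective g -> range g = Wu_fsq R c ->
  g 0 = c -> smooth R g -> derive1 g 0 = v -> 0 < - (v.1 * c.2 + c.1 * v.2) ->
  forall t, (t < 0 -> branch_sign (g t) < 0) /\ (0 < t -> 0 < branch_sign (g t)).
Proof.
move=> cs gi gr g0 gs gv v0.
have dg t : derivable g t 1 by exact: (gs 0%N t).
have cg : continuous g.
  by move=> t; apply: differentiable_continuous; exact/derivable1_diffP.
have cpg : continuous (branch_sign \o g).
  by move=> t; apply: continuous_comp; [exact: cg|exact: branch_sign_continuous].
have wu t : Wu_fsq R c (g t) by rewrite -gr; exists t.
have zero t : branch_sign (g t) = 0 -> t = 0.
  move=> h; apply: gi; rewrite g0; apply: saddle_fsq_unique => //.
  by apply: branch_sign_eq0 => //; have [] := Wu_fsq_history _ _ _ cs (wu t).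
have g00 : branch_sign (g 0) = 0 by rewrite g0; exact: branch_sign_saddle.
have D := branch_sign_derivative _ _ (dg 0) gv g00; rewrite g0 in D.
have : \forall h \near 0^', 0 < h^-1 * branch_sign (g h).
  exact: (cvgr_gt _ D _ v0).
rewrite /dnbhs /within /= => /nbhs_ballP[e /= e0 he].
have e2 : 0 < e / 2 < e by apply/andP; split; lra.
have [e20 e2e] := andP e2.
have pos : 0 < branch_sign (g (e / 2)).
  have := he (e / 2); rewrite /ball /= sub0r normrN gtr0_norm// => /(_ e2e).
  by move=> /(_ (lt0r_neq0 e20)); rewrite pmulr_rgt0// invr_gt0.
have neg : branch_sign (g (- (e / 2))) < 0.
  have := he (- (e / 2)); rewrite /ball /= sub0r opprK gtr0_norm// => /(_ e2e).
  rewrite oppr_eq0 => /(_ (lt0r_neq0 e20)).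
  by rewrite nmulr_rgt0// invr_lt0 oppr_lt0.
have ivt s t : s <= t ->
    Num.min (branch_sign (g s)) (branch_sign (g t)) <= 0 <=
      Num.max (branch_sign (g s)) (branch_sign (g t)) ->
    s <= 0 <= t.
  move=> st /(@IVT R (branch_sign \o g) s t 0 st)[|r]; first exact: continuous_subspaceT.
  by rewrite in_itv /= => rst /zero <-.
move=> t; split=> t0; rewrite ltNge; apply/negP => h.
- have [ts|ts] := leP t (- (e / 2)).
    have /andP[_] := ivt _ _ ts ltac:(rewrite ge_min le_max h (ltW neg) ?orbT//); lra.
  have /andP[_] := ivt _ _ (ltW ts) ltac:(rewrite ge_min le_max h (ltW neg) ?orbT//); lra.
- have [ts|ts] := leP t (e / 2).
    have /andP[] := ivt _ _ ts ltac:(rewrite ge_min le_max h (ltW pos) ?orbT//); lra.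
  have /andP[] := ivt _ _ (ltW ts) ltac:(rewrite ge_min le_max h (ltW pos) ?orbT//); lra.
Qed.

Lemma negative_branch c v g : saddle_pt R c -> injective g -> range g = Wu_fsq R c ->
  g 0 = c -> smooth R g -> derive1 g 0 = v -> 0 < - (v.1 * c.2 + c.1 * v.2) ->
  g @` [set t | t < 0] = [set q | Wu_fsq R c q /\ branch_sign q < 0].
Proof.
move=> cs gi gr g0 gs gv v0; have sg := branch_signs _ _ _ cs gi gr g0 gs gv v0.
apply/seteqP; split=> [_ [t /= t0 <-]|q /= []].
  by split; [rewrite -gr; exists t|exact: (sg t).1].
rewrite -gr => -[t _ <-] h; exists t => //=; rewrite ltNge; apply/negP => t0.
have [t1|t1] := ltP 0 t; first by have := (sg t).2 t1; lra.
have tE : t = 0 by lra.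
by move: h; rewrite tE g0 branch_sign_saddle// ltxx.
Qed.

Lemma Wu_negE v v' g g' : unstable_param (p R) (Q3 R) v g ->
  unstable_param (p' R) (Q3' R) v' g' ->
  Wu_neg g g' = [set q | saddle_history R q /\ branch_sign q < 0].
Proof.
have a0 := @saddle_coord_gt0 R.
move=> [_ /points_into_Q3[v1 v2] [s1 i1 r1 z1 d1]].
move=> [_ /points_into_Q3'[w1 w2] [s2 i2 r2 z2 d2]].
have ps : saddle_pt R (p R) by left.
have ps' : saddle_pt R (p' R) by right.
rewrite /Wu_neg (negative_branch _ _ _ ps i1 r1 z1 s1 d1); last first.
  rewrite /= mulNr mulrC -mulrBr -mulrN opprB mulr_gt0//; lra.
rewrite (negative_branch _ _ _ ps' i2 r2 z2 s2 d2); last first.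
  rewrite /= mulrN mulrC addrC -mulrBr -mulrN opprB mulr_gt0//; lra.
apply/seteqP; split=> q /=.
  by move=> [] [w n]; split=> //; [exact: Wu_fsq_history w|exact: Wu_fsq_history w].
by move=> [/saddle_history_fsq[] w n]; [left|right].
Qed.

End Branches.

(** * Moduli and Cauchy estimates for complex polynomials *)

Section Modulus.
Local Open Scope complex_scope.
Variable R : realType.
Implicit Types (z w : R[i]).

Definition cabs z : R := Normc.normc z.

Lemma normE z : `|z| = (cabs z)%:C. Proof. by []. Qed.

Lemma cabs_ge0 z : 0 <= cabs z.
Proof. by rewrite -lecR -normE normr_ge0. Qed.

Lemma cabsM z w : cabs (z * w) = cabs z * cabs w.
Proof. exact: Normc.normcM. Qed.

Lemma cabsD z w : cabs (z + w) <= cabs z + cabs w.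
Proof. by rewrite -lecR rmorphD -!normE; exact: ler_normD. Qed.

Lemma cabsN z : cabs (- z) = cabs z.
Proof. by apply: (@complexI R); rewrite -!normE normrN. Qed.

Lemma cabsB z w : cabs (z - w) <= cabs z + cabs w.
Proof. by rewrite -(cabsN w) cabsD. Qed.

Lemma cabs_real (r : R) : cabs r%:C = `|r|.
Proof. by rewrite /cabs /= expr0n /= addr0 sqrtr_sqr. Qed.

Lemma cabsX z n : cabs (z ^+ n) = cabs z ^+ n.
Proof.
elim: n => [|n IH]; last by rewrite !exprS cabsM IH.
by rewrite !expr0 (_ : 1 = 1%:C)// cabs_real normr1.
Qed.

Lemma cabsZ (r : R) z : cabs (r%:C * z) = `|r| * cabs z.
Proof. by rewrite cabsM cabs_real. Qed.

Lemma half_complex : 1 / 2 = (1 / 2 : R)%:C :> R[i].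
Proof. by rewrite fmorph_div rmorph1 rmorph_nat. Qed.

Lemma ratio_complex (m n : nat) : m%:R / n%:R = (m%:R / n%:R : R)%:C :> R[i].
Proof. by rewrite fmorph_div !rmorph_nat. Qed.

End Modulus.

Section PolynomialBounds.
Local Open Scope complex_scope.
Variable R : realType.
Implicit Types (P Q : {poly R[i]}).

(** A weak maximum principle without integrals.  Averaging over t and -t replaces P by
its even part, a polynomial in t^2 of at most half the degree and with the same value
at 0; on the circle of radius r^2 every point is a square of a point of radius r. *)
Lemma mean_value_bound P (r M : R) : 0 < r ->
  (forall t, cabs R t = r -> cabs R P.[t] <= M) -> cabs R P.[0] <= M.
Proof.
have [n] := ubnP (size P); elim: n => // n IH in P r *; rewrite ltnS => sP r0 hP.
have [s1|s1] := leqP (size P) 1.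
  have := hP r%:C; rewrite cabs_real gtr0_norm// => /(_ erefl).
  by rewrite (size1_polyC s1) !hornerC.
have evenE t : (even_poly P).[t ^+ 2] = (1 / 2 : R)%:C * (P.[t] + P.[- t]).
  have D := poly_even_odd P.
  rewrite -half_complex -{2 3}D !hornerD !hornerM !horner_comp !hornerXn !hornerX sqrrN.
  by field.
have -> : P.[0] = (even_poly P).[0].
  have := evenE 0; rewrite expr0n /= oppr0 => ->.
  by rewrite -half_complex; field.
apply: (IH _ (r ^+ 2)); last first.
- move=> s sr; rewrite -(sqrtCK s) evenE cabsZ gtr0_norm; last lra.
  have tr : cabs R (sqrtC s) = r.
    apply/eqP; rewrite -(@eqrXn2 _ 2) ?cabs_ge0 ?(ltW r0)// -cabsX sqrtCK.
    exact/eqP.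
  have := cabsD _ P.[sqrtC s] P.[- sqrtC s].
  have := hP _ tr; have := hP (- sqrtC s); rewrite cabsN => /(_ tr); lra.
- by rewrite exprn_gt0.
- apply: leq_trans sP; apply: leq_ltn_trans (size_even_poly P) _.
  by case: (size P) s1 => [|[|k]] // _; rewrite /= ltnS; rewrite uphalf_half; lia.
Qed.

(** Cauchy estimate, obtained from the mean value bound for (P - P(0)) / X; the factor 2
comes from bounding P - P(0). *)
Lemma derivative_bound P (r M : R) : 0 < r ->
  (forall t, cabs R t <= r -> cabs R P.[t] <= M) ->
  cabs R (deriv P).[0] <= 2 * M / r.
Proof.
elim/poly_ind: P => [|Q c _] r0 hP.
  have := hP 0; rewrite deriv0 horner0 (_ : 0 = 0%:C)// cabs_real normr0.
  move=> /(_ (ltW r0)) M0.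
  by rewrite divr_ge0 ?mulr_ge0// ltW.
have -> : (deriv (Q * 'X + c%:P)).[0] = Q.[0].
  by rewrite derivD derivM derivX derivC !hornerE.
apply: (@mean_value_bound Q r) => // t tr.
have h0 : cabs R c <= M.
  have := hP 0; rewrite !hornerE; apply.
  by rewrite (_ : 0 = 0%:C)// cabs_real normr0 ltW.
have := hP t; rewrite tr lexx !hornerE => /(_ isT) ht.
rewrite ler_pdivlMr// -[r]tr -cabsM.
have -> : Q.[t] * t = (Q.[t] * t + c) - c by rewrite addrK.
by rewrite (le_trans (cabsB _ _ _))//; lra.
Qed.

End PolynomialBounds.

(** * Bounded orbits in the complex plane *)

Section ComplexPlane.
Local Open Scope complex_scope.
Variable R : realType.
Local Notation C2 := (R[i]^o * R[i]^o)%type.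
Implicit Types (s t : C2).

Definition cnorm s : R := Num.max (cabs R s.1) (cabs R s.2).

Lemma cnormE s : `|s| = (cnorm s)%:C.
Proof.
rewrite prod_normE !normE /cnorm.
by rewrite /Num.max /Order.max ltcR; case: ifP.
Qed.

Lemma cnorm_ge s : cabs R s.1 <= cnorm s /\ cabs R s.2 <= cnorm s.
Proof. by rewrite /cnorm !le_max !lexx orbT. Qed.

Lemma bounded_orbitP (g : C2 -> C2) s :
  bounded_orbit R g s <-> exists M, forall n, cnorm (iter n g s) <= M.
Proof.
split=> [[M [Mr hM]]|[M hM]].
  exists (complex.Re M + 1) => n.
  have := hM (complex.Re M + 1)%:C _ (iter n g s).
  rewrite -{1}(RRe_real Mr) ltcR ltrDl ltr01 => /(_ isT) /(_ _)/= h.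
  by rewrite -lecR -cnormE; apply: h; exists n.
exists M%:C; split; first by apply/complex_realP; exists M.
move=> x Mx _ [n _ <-]; rewrite /= cnormE.
by rewrite (le_trans _ (ltW Mx))// lecR.
Qed.

Lemma nbhs_cnormP s (A : set C2) :
  nbhs s A <-> exists2 r : R, 0 < r & forall t, cnorm (t - s) < r -> A t.
Proof.
have key (r : R) t : `|s - t| < r%:C <-> cnorm (t - s) < r.
  by rewrite -normrN opprB cnormE ltcR.
split=> [/nbhs_normP[e /= e0 he]|[r r0 hr]].
  have er : (complex.Re e)%:C = e by rewrite RRe_real// gtr0_real.
  exists (complex.Re e); first by rewrite -ltcR er.
  by move=> t ts; apply: he; rewrite /= -er; apply/key.
apply: (@nbhs_normP _ _ s A).2; exists r%:C; first by rewrite /= ltcR.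
by move=> t /= /key; exact: hr.
Qed.

Lemma cnormD s t : cnorm (s + t) <= cnorm s + cnorm t.
Proof.
have [s1 s2] := cnorm_ge s; have [t1 t2] := cnorm_ge t.
rewrite {1}/cnorm ge_max; apply/andP; split.
  by apply: le_trans (cabsD _ s.1 t.1) _; rewrite lerD.
by apply: le_trans (cabsD _ s.2 t.2) _; rewrite lerD.
Qed.

Lemma cnorm_ge0 s : 0 <= cnorm s.
Proof. by have [s1 _] := cnorm_ge s; exact: le_trans (cabs_ge0 _ _) s1. Qed.

Lemma cnormN s : cnorm (- s) = cnorm s.
Proof. by rewrite /cnorm !cabsN. Qed.

Lemma cnorm_real_pt (q : R * R) : cnorm (real_pt R q) = Num.max `|q.1| `|q.2|.
Proof. by rewrite /cnorm !cabs_real. Qed.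

Lemma fC_continuous : continuous (fC R).
Proof. exact: (@henon_continuous R[i]). Qed.

Lemma fCinv_continuous : continuous (fCinv R).
Proof. exact: (@henon_inv_continuous R[i]). Qed.

Lemma iter_near (g : C2 -> C2) s n (e : R) : continuous g -> 0 < e ->
  \forall t \near nbhs s, cnorm (iter n g t - iter n g s) < e.
Proof.
move=> cg e0; have h : nbhs (iter n g s) [set t | cnorm (t - iter n g s) < e].
  by apply/nbhs_cnormP; exists e.
exact: (iter_continuous _ _ n cg s _ h).
Qed.

Definition uniformly_bounded (g : C2 -> C2) := forall s, bounded_orbit R g s ->
  forall n, cnorm (iter n g s) <= Num.max 2 (cnorm s).

(** A uniform bound valid on bounded orbits passes to the limit, up to the constant lost
by comparing with an orbit that is close at a single time. *)
Lemma closed_bounded_orbits (g : C2 -> C2) : continuous g -> uniformly_bounded g ->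
  closed (bounded_orbit R g).
Proof.
move=> cg ug s cs; apply/bounded_orbitP; exists (2 + (cnorm s + 1) + 1) => n.
(* A bounded orbit starting within distance 1 of s and within distance 1 of it at time n. *)
have [t [bt [t1 t2]]] : bounded_orbit R g `&`
    [set t | cnorm (iter n g t - iter n g s) < 1 /\ cnorm (t - s) < 1] !=set0.
  apply: cs; apply: filterI; first exact: iter_near.
  by apply/nbhs_cnormP; exists 1.
have h1 : cnorm (iter n g s) <= cnorm (iter n g t) + cnorm (iter n g t - iter n g s).
  by rewrite -[X in _ + X]cnormN (le_trans _ (cnormD _ _))// subKr.
have h2 : cnorm t <= cnorm s + cnorm (t - s).
  by rewrite (le_trans _ (cnormD _ _))// addrC subrK.
have := ug _ bt n; rewrite le_max => /orP[] h3; have := cnorm_ge0 s; lra.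
Qed.

(** Once a term is at least 2 and not below its predecessor, the sequence doubles
for ever.  So each term of a bounded sequence is below 2 or below its predecessor. *)
Lemma escape_bound (w : nat -> R) (M : R) :
  (forall n, 2 <= w n.+1 -> w n <= w n.+1 -> 2 * w n.+1 <= w n.+2) ->
  (forall n, w n <= M) -> forall n, w n <= Num.max 2 (w 0%N).
Proof.
move=> esc wM; have step n : w n.+1 < 2 \/ w n.+1 < w n.
  have [h2|] := ltP (w n.+1) 2; first by left.
  move=> h2; have [hw|hw] := ltP (w n.+1) (w n); [by right|exfalso].
  have grow k : 2 * 2 ^+ k <= w (n + k).+1 /\ w (n + k)%N <= w (n + k).+1.
    elim: k => [|k [h3 h4]]; first by rewrite expr0 addn0 mulr1.
    have k1 : 1 <= 2 ^+ k :> R by rewrite exprn_ege1// ler1n.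
    rewrite addnS exprS; have := esc (n + k)%N ltac:(lra) h4; lra.
  have [k hk] := @pow2_archimedean _ M 1 ltr01.
  have [h3 _] := grow k; have := wM (n + k).+1.
  have p0 : 0 < 2 ^+ k :> R by rewrite exprn_gt0.
  move: hk; rewrite ler_pdivrMr// mul1r => hk h5; lra.
elim=> [|n IH]; first by rewrite le_max lexx orbT.
have [h|h] := step n; last by rewrite (le_trans (ltW h)).
by rewrite le_max ltW.
Qed.

Lemma iter_fC_fst s n : (iter n.+1 (fC R) s).1 = (iter n (fC R) s).2.
Proof. by []. Qed.

Lemma iter_fCinv_snd s n : (iter n.+1 (fCinv R) s).2 = (iter n (fCinv R) s).1.
Proof. by []. Qed.

Lemma fC_escape s : 2 <= cabs R s.2 -> cabs R s.1 <= cabs R s.2 ->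
  2 * cabs R s.2 <= cabs R (fC R s).2.
Proof.
move=> h2 h12.
have e : s.2 ^+ 3 = ((1 / 2 : R)%:C * s.1 + (3 / 4 : R)%:C * s.2) - (fC R s).2.
  by rewrite -half_complex -ratio_complex /fC /henon /=; field.
have := cabsB _ ((1 / 2 : R)%:C * s.1 + (3 / 4 : R)%:C * s.2) (fC R s).2.
rewrite -e cabsX; have := cabsD _ ((1 / 2 : R)%:C * s.1) ((3 / 4 : R)%:C * s.2).
rewrite !cabsZ !gtr0_norm; [|lra..].
move: (cabs R s.2) (cabs R s.1) h2 h12 => y x h2 h12.
have : 4 * y <= y ^+ 3.
  rewrite exprSr; apply: ler_wpM2r; first lra.
  by rewrite (_ : 4 = 2 ^+ 2) ?ler_sqr ?nnegrE; lra.
lra.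
Qed.

Lemma fCinv_escape s : 2 <= cabs R s.1 -> cabs R s.2 <= cabs R s.1 ->
  2 * cabs R s.1 <= cabs R (fCinv R s).1.
Proof.
move=> h2 h12; have e : (2 : R)%:C * s.1 ^+ 3 =
    (fCinv R s).1 - ((- (3 / 2) : R)%:C * s.1 + (2 : R)%:C * s.2).
  by rewrite rmorphN fmorph_div !rmorph_nat /fCinv /henon_inv /=; field.
have := cabsB _ (fCinv R s).1 ((- (3 / 2) : R)%:C * s.1 + (2 : R)%:C * s.2).
rewrite -e cabsZ cabsX; have := cabsD _ ((- (3 / 2) : R)%:C * s.1) ((2 : R)%:C * s.2).
rewrite !cabsZ normrN !gtr0_norm; [|lra..].
move: (cabs R s.2) (cabs R s.1) h2 h12 => y x h2 h12.
have : 4 * x <= x ^+ 3.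
  rewrite exprSr; apply: ler_wpM2r; first lra.
  by rewrite (_ : 4 = 2 ^+ 2) ?ler_sqr ?nnegrE; lra.
lra.
Qed.

Lemma fC_uniformly_bounded : uniformly_bounded (fC R).
Proof.
move=> s /bounded_orbitP[M hM] n.
pose w n := cabs R (iter n (fC R) s).1.
have wM k : w k <= M by apply: le_trans (hM k); have [] := cnorm_ge (iter k (fC R) s).
have esc k : 2 <= w k.+1 -> w k <= w k.+1 -> 2 * w k.+1 <= w k.+2.
  by rewrite /w !iter_fC_fst => h1 h2; exact: fC_escape.
have B k : w k <= Num.max 2 (cnorm s).
  apply: le_trans (escape_bound _ _ esc wM k) _.
  have [h _] := cnorm_ge s; rewrite ge_max; apply/andP; split; first by rewrite le_max lexx.
  by apply: le_trans h _; rewrite le_max lexx orbT.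
by rewrite {1}/cnorm ge_max (B n); have := B n.+1; rewrite /w iter_fC_fst => ->.
Qed.

Lemma fCinv_uniformly_bounded : uniformly_bounded (fCinv R).
Proof.
move=> s /bounded_orbitP[M hM] n.
pose w n := cabs R (iter n (fCinv R) s).2.
have wM k : w k <= M by apply: le_trans (hM k); have [] := cnorm_ge (iter k (fCinv R) s).
have esc k : 2 <= w k.+1 -> w k <= w k.+1 -> 2 * w k.+1 <= w k.+2.
  by rewrite /w !iter_fCinv_snd => h1 h2; exact: fCinv_escape.
have B k : w k <= Num.max 2 (cnorm s).
  apply: le_trans (escape_bound _ _ esc wM k) _.
  have [_ h] := cnorm_ge s; rewrite ge_max; apply/andP; split; first by rewrite le_max lexx.
  by apply: le_trans h _; rewrite le_max lexx orbT.
by rewrite {1}/cnorm ge_max (B n) andbT; have := B n.+1; rewrite /w iter_fCinv_snd => ->.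
Qed.

Lemma Kplus_closed : closed (Kplus R).
Proof. exact: closed_bounded_orbits fC_continuous fC_uniformly_bounded. Qed.

Lemma Kminus_closed : closed (Kminus R).
Proof. exact: closed_bounded_orbits fCinv_continuous fCinv_uniformly_bounded. Qed.

End ComplexPlane.

(** * Derivatives of the iterates at interior points *)

Section Tangent.
Variable F : numFieldType.

Definition Dhenon (q v : F * F) : F * F :=
  (v.2, v.1 / 2 + (3 / 4 - 3 * q.2 ^+ 2) * v.2).

Definition Dhenon_inv (q v : F * F) : F * F :=
  ((6 * q.1 ^+ 2 - 3 / 2) * v.1 + 2 * v.2, v.1).

Implicit Types PQ : {poly F} * {poly F}.

Definition eval (t : F) PQ : F * F := (PQ.1.[t], PQ.2.[t]).
Definition velocity PQ : F * F := ((deriv PQ.1).[0], (deriv PQ.2).[0]).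
Definition line (q v : F * F) : {poly F} * {poly F} :=
  (v.1 *: 'X + q.1%:P, v.2 *: 'X + q.2%:P).

(** The map f acting on polynomial curves; since f is polynomial, f^n along a line is a
polynomial in the parameter and the Cauchy estimate applies to it. *)
Definition henon_poly PQ : {poly F} * {poly F} :=
  (PQ.2, (1 / 2) *: PQ.1 - PQ.2 ^+ 3 + (3 / 4) *: PQ.2).
Definition henon_inv_poly PQ : {poly F} * {poly F} :=
  (2 *: PQ.1 ^+ 3 - (3 / 2) *: PQ.1 + 2 *: PQ.2, PQ.1).

Lemma eval_line t q v : eval t (line q v) = (v.1 * t + q.1, v.2 * t + q.2).
Proof. by rewrite /eval /line /= !hornerD !hornerZ !hornerX !hornerC. Qed.

Lemma velocity_line q v : velocity (line q v) = v.
Proof.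
rewrite /velocity /line /= !derivD !derivZ !derivX !derivC !addr0 !hornerZ !hornerC !mulr1.
by case: v.
Qed.

Lemma eval_henon_poly PQ t : eval t (henon_poly PQ) = henon F (eval t PQ).
Proof.
rewrite /eval /henon_poly /henon /= !hornerD hornerN !hornerZ horner_exp.
by congr pair; field.
Qed.

Lemma eval_henon_inv_poly PQ t : eval t (henon_inv_poly PQ) = henon_inv F (eval t PQ).
Proof.
rewrite /eval /henon_inv_poly /henon_inv /= !hornerD hornerN !hornerZ horner_exp.
by congr pair; field.
Qed.

Lemma velocity_henon_poly PQ : velocity (henon_poly PQ) = Dhenon (eval 0 PQ) (velocity PQ).
Proof.
rewrite /velocity /henon_poly /Dhenon /eval /= !derivD derivN !derivZ deriv_exp.
rewrite !hornerD hornerN !hornerZ hornerMn hornerM horner_exp /=.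
by congr pair; field.
Qed.

Lemma velocity_henon_inv_poly PQ :
  velocity (henon_inv_poly PQ) = Dhenon_inv (eval 0 PQ) (velocity PQ).
Proof.
rewrite /velocity /henon_inv_poly /Dhenon_inv /eval /= !derivD derivN !derivZ deriv_exp.
rewrite !hornerD hornerN !hornerZ hornerMn hornerM horner_exp /=.
by congr pair; field.
Qed.

End Tangent.

Section Interior.
Local Open Scope complex_scope.
Variable R : realType.
Local Notation C2 := (R[i]^o * R[i]^o)%type.
Implicit Types (s v : C2).

(** A small complex disc in the direction v consists of bounded orbits, on which all
iterates of g share one bound; the Cauchy estimate turns it into a bound for the
derivatives. *)
Lemma interior_velocity_bounded (g : C2 -> C2)
    (G : {poly R[i]} * {poly R[i]} -> {poly R[i]} * {poly R[i]}) s v :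
  uniformly_bounded R g -> (forall PQ t, eval _ t (G PQ) = g (eval _ t PQ)) ->
  (bounded_orbit R g : set C2)° s ->
  exists M, forall n, cnorm R (velocity _ (iter n G (line _ s v))) <= M.
Proof.
move=> ug Gg /nbhs_cnormP[r r0 hr].
have v0 := cnorm_ge0 R v; pose e := r / (2 * (cnorm R v + 1)).
have e0 : 0 < e by rewrite divr_gt0// mulr_gt0//; lra.
pose M := Num.max 2 (cnorm R s + r).
have near_line t : cabs R t <= e -> cnorm R (eval _ t (line _ s v) - s) < r.
  move=> te; have -> : eval _ t (line _ s v) - s = (v.1 * t, v.2 * t) :> C2.
    by rewrite eval_line /=; apply/eqP; rewrite xpair_eqE /= !addrK !eqxx.
  have h x : cabs R x <= cnorm R v -> cabs R (x * t) < r.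
    move=> hx; rewrite cabsM; apply: (@le_lt_trans _ _ (cnorm R v * e)).
      by rewrite ler_pM// cabs_ge0.
    rewrite /e mulrA ltr_pdivrMr; last by rewrite mulr_gt0//; lra.
    by rewrite mulrC ltr_pM2l//; lra.
  by have [h1 h2] := cnorm_ge R v; rewrite /cnorm gt_max !h.
have iterG n t PQ : eval _ t (iter n G PQ) = iter n g (eval _ t PQ).
  by elim: n => [//|n IH]; rewrite !iterS Gg IH.
have bound n t : cabs R t <= e -> cnorm R (eval _ t (iter n G (line _ s v))) <= M.
  move=> te; have hs := near_line _ te; rewrite iterG.
  apply: le_trans (ug _ (hr _ hs) n) _; rewrite /M ge_max !le_max lexx /=.
  apply/orP; right.
  rewrite -(subrK s (eval _ t _)) addrC (le_trans (cnormD _ _ _))// lerD2l ltW//.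
exists (2 * M / e) => n.
rewrite {1}/cnorm ge_max; apply/andP; split; apply: derivative_bound => // t te.
  have [h _] := cnorm_ge R (eval _ t (iter n G (line _ s v))).
  by apply: le_trans h (bound n t te).
have [_ h] := cnorm_ge R (eval _ t (iter n G (line _ s v))).
by apply: le_trans h (bound n t te).
Qed.

(** Two tangent vectors with bounded images under all iterates of the inverse would have
bounded wedge product, but it is multiplied by -2 at each step. *)
Lemma Kminus_interior0 s : ~ (Kminus R)° s.
Proof.
move=> hs; pose G := henon_inv_poly R[i].
have hG PQ t : eval _ t (G PQ) = fCinv R (eval _ t PQ) by exact: eval_henon_inv_poly.
have uK := fCinv_uniformly_bounded R.
have [M1 h1] := interior_velocity_bounded _ G s (1, 0) uK hG hs.
have [M2 h2] := interior_velocity_bounded _ G s (0, 1) uK hG hs.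
pose v n := velocity _ (iter n G (line _ s (1, 0))).
pose w n := velocity _ (iter n G (line _ s (0, 1))).
have ev0 n u : eval _ 0 (iter n G (line _ s u)) = iter n (fCinv R) s.
  elim: n => [|n IH]; first by rewrite eval_line !mulr0 !add0r -surjective_pairing.
  by rewrite !iterS hG IH.
have vS n : v n.+1 = Dhenon_inv _ (iter n (fCinv R) s) (v n).
  by rewrite /v iterS velocity_henon_inv_poly ev0.
have wS n : w n.+1 = Dhenon_inv _ (iter n (fCinv R) s) (w n).
  by rewrite /w iterS velocity_henon_inv_poly ev0.
pose det n := (v n).1 * (w n).2 - (v n).2 * (w n).1.
have detE n : cabs R (det n) = 2 ^+ n.
  elim: n => [|n IH].
    have -> : det 0%N = 1%:C.
      by rewrite /det [v 0%N]velocity_line [w 0%N]velocity_line mulr1 mulr0 subr0.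
    by rewrite cabs_real normr1 expr0.
  have -> : det n.+1 = (- 2 : R)%:C * det n.
    by rewrite /det vS wS /Dhenon_inv /= rmorphN rmorph_nat; ring.
  by rewrite cabsZ IH normrN ger0_norm// exprS.
have M10 : 0 <= M1 by exact: le_trans (cnorm_ge0 _ _) (h1 0%N).
have M20 : 0 <= M2 by exact: le_trans (cnorm_ge0 _ _) (h2 0%N).
have bdet n : 2 ^+ n <= 2 * M1 * M2.
  rewrite -detE; apply: le_trans (cabsB _ _ _) _; rewrite !cabsM.
  have [v1 v2] := cnorm_ge R (v n); have [w1 w2] := cnorm_ge R (w n).
  have a1 := le_trans v1 (h1 n); have a2 := le_trans v2 (h1 n).
  have b1 := le_trans w1 (h2 n); have b2 := le_trans w2 (h2 n).
  have k1 : cabs R (v n).1 * cabs R (w n).2 <= M1 * M2 by rewrite ler_pM ?cabs_ge0.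
  have k2 : cabs R (v n).2 * cabs R (w n).1 <= M1 * M2 by rewrite ler_pM ?cabs_ge0.
  lra.
have [k hk] := @pow2_archimedean R (2 * M1 * M2 + 1) 1 ltr01.
have p0 : 0 < 2 ^+ k :> R by rewrite exprn_gt0.
by move: hk; rewrite ler_pdivrMr// mul1r; have := bdet k; lra.
Qed.

End Interior.

(** * Real points of the filled Julia sets *)

Section RealSlices.
Local Open Scope complex_scope.
Variable R : realType.
Local Notation C2 := (R[i]^o * R[i]^o)%type.
Local Notation a := (Num.sqrt (5 : R) / 2).
Local Notation saddles := [set p R; p' R].
Local Notation orbit q n := (iter n (fR R) q).
Local Notation back q n := (iter n (fRinv R) q).
Implicit Types (q v : R * R) (s : C2).

Lemma real_pt_fR q : real_pt R (fR R q) = fC R (real_pt R q).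
Proof.
rewrite /real_pt /fR /fC /henon /=; congr pair.
by rewrite rmorphD rmorphB !rmorphM !fmorphV !rmorph_nat.
Qed.

Lemma real_pt_fRinv q : real_pt R (fRinv R q) = fCinv R (real_pt R q).
Proof.
rewrite /real_pt /fRinv /fCinv /henon_inv /=; congr pair.
by rewrite rmorphD rmorphB !rmorphM !fmorphV !rmorph_nat.
Qed.

Lemma real_pt_orbit q n : real_pt R (orbit q n) = iter n (fC R) (real_pt R q).
Proof. by elim: n => [//|n IH]; rewrite !iterS real_pt_fR IH. Qed.

Lemma real_pt_back q n : real_pt R (back q n) = iter n (fCinv R) (real_pt R q).
Proof. by elim: n => [//|n IH]; rewrite !iterS real_pt_fRinv IH. Qed.

Lemma Kplus_real q : Kplus R (real_pt R q) <-> forward_bounded R q.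
Proof.
split=> [/bounded_orbitP[M hM]|[M hM]].
  exists M => n; have := hM n; rewrite -real_pt_orbit cnorm_real_pt ge_max.
  by move=> /andP[].
apply/bounded_orbitP; exists M => n.
by rewrite -real_pt_orbit cnorm_real_pt ge_max hM orbit_snd hM.
Qed.

Lemma Kminus_real q : Kminus R (real_pt R q) <-> backward_bounded R q.
Proof.
split=> [/bounded_orbitP[M hM]|[M hM]].
  exists M => n; have := hM n; rewrite -real_pt_back cnorm_real_pt ge_max.
  by move=> /andP[].
apply/bounded_orbitP; exists M => n.
by rewrite -real_pt_back cnorm_real_pt ge_max hM backward_fst hM.
Qed.

Fixpoint tangent q v n :=
  if n is m.+1 then Dhenon R (orbit q m) (tangent q v m) else v.

Lemma tangent_onto q n w : exists v, tangent q v n = w.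
Proof.
elim: n w => [|n IH] w; first by exists w.
have [v hv] := IH (2 * (w.2 - (3 / 4 - 3 * (orbit q n).2 ^+ 2) * w.1), w.1).
exists v; rewrite /= hv /Dhenon /= [RHS]surjective_pairing; congr pair.
by field.
Qed.

Lemma real_pt_tangent q v n :
  velocity _ (iter n (henon_poly R[i]) (line _ (real_pt R q) (real_pt R v))) =
  real_pt R (tangent q v n).
Proof.
have ev0 k : eval _ 0 (iter k (henon_poly R[i]) (line _ (real_pt R q) (real_pt R v))) =
    real_pt R (orbit q k).
  elim: k => [|k IH]; first by rewrite eval_line !mulr0 !add0r.
  by rewrite !iterS eval_henon_poly IH real_pt_fR.
elim: n => [|n IH]; first by rewrite velocity_line.
rewrite iterS velocity_henon_poly IH ev0 /Dhenon /real_pt /=; congr pair.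
by rewrite rmorphD !rmorphM rmorphB !rmorphM !fmorphV !rmorph_nat.
Qed.

(** The sign sg treats both saddles at once: the entry 3/4 - 3 y^2 of Df is 3/4 at the
origin and -3 on the cycle.  The cone sg * v.1 * v.2 >= 0 is mapped into itself and its
vectors are expanded. *)
Lemma tangent_unbounded q N (sg : R) : sg * sg = 1 ->
  (forall n, (N <= n)%N -> 7 / 10 <= sg * (3 / 4 - 3 * (orbit q n).2 ^+ 2)) ->
  exists v, forall M, exists n, M < `|(tangent q v n).1|.
Proof.
move=> sg2 hc; (* A vector whose image at time N lies in the expanded cone. *)
have [v hv] := tangent_onto q N (1, sg).
exists v => M.
have grow k : 1 + k%:R / 5 <= (tangent q v (N + k.*2)).1 /\
    1 + k%:R / 5 <= sg * (tangent q v (N + k.*2)).2.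
  elim: k => [|k [h1 h2]]; first by rewrite addn0 hv /= sg2 mul0r addr0.
  rewrite doubleS !addnS /=.
  have c1 := hc (N + k.*2)%N (leq_addr _ _).
  have c2 := hc (N + k.*2).+1 (leqW (leq_addr _ _)); rewrite /= in c2.
  move: c1 c2; rewrite -!/(orbit q _).
  move: (3 / 4 - 3 * (orbit q (N + k.*2)).2 ^+ 2) => c.
  set c' := 3 / 4 - _ => hc1 hc2.
  move: (tangent q v (N + k.*2)) h1 h2 => [x y] /= h1 h2.
  have k0 : 0 <= k%:R / 5 :> R by rewrite divr_ge0.
  rewrite -[k.+1]addn1 natrD.
  have e1 : c * y = (sg * c) * (sg * y) by rewrite mulrACA sg2 mul1r.
  have g1 : 7 / 10 * (sg * y) <= c * y by rewrite e1 ler_wpM2r//; lra.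
  set z := x / 2 + c * y.
  have zb : 12 / 10 * (1 + k%:R / 5) <= z by rewrite /z; lra.
  have g2 : 7 / 10 * z <= (sg * c') * z by rewrite ler_wpM2r//; lra.
  have -> : sg * (y / 2 + c' * z) = (sg * y) / 2 + (sg * c') * z by field.
  by split; lra.
have [n Mn] : exists n : nat, M < n%:R / 5.
  exists (Num.truncn (5 * M)).+1; have := truncnS_gt (5 * M); lra.
exists (N + n.*2)%N; have [h _] := grow n.
by have := ler_norm (tangent q v (N + n.*2)).1; lra.
Qed.

Lemma Kplus_not_interior q N (sg : R) : sg * sg = 1 ->
  (forall n, (N <= n)%N -> 7 / 10 <= sg * (3 / 4 - 3 * (orbit q n).2 ^+ 2)) ->
  ~ (Kplus R)° (real_pt R q).
Proof.
move=> sg2 hc hs; have [v hv] := tangent_unbounded _ _ _ sg2 hc.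
have hG PQ t : eval _ t (henon_poly R[i] PQ) = fC R (eval _ t PQ).
  exact: eval_henon_poly.
have [M hM] :=
  interior_velocity_bounded _ _ _ _ (real_pt R v) (fC_uniformly_bounded R) hG hs.
have [n] := hv M; apply/negP; rewrite -leNgt.
have := hM n; rewrite real_pt_tangent cnorm_real_pt ge_max => /andP[h _].
exact: h.
Qed.

Lemma Ws0_not_interior q : Ws0 R q -> ~ (Kplus R)° (real_pt R q).
Proof.
move=> /cvg_coordP[_ /cvgrPdist_le/(_ (1 / 10) ltac:(lra))[N _ hN]].
apply: (Kplus_not_interior _ N 1); first by rewrite mulr1.
move=> n Nn; have := hN n Nn; rewrite /= sub0r normrN mul1r => h.
have : `|(orbit q n).2| ^+ 2 <= (1 / 10) ^+ 2 by rewrite ler_sqr ?nnegrE//; lra.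
rewrite real_normK ?num_real//; lra.
Qed.

Lemma Wspp'_not_interior q : Wspp' R q -> ~ (Kplus R)° (real_pt R q).
Proof.
move=> /Wspp'_near[N hN]; apply: (Kplus_not_interior _ N (-1)).
  by rewrite mulrNN mulr1.
move=> n Nn; have := hN (n - N)%N; rewrite subnK// => /near_saddle_abs[_ /andP[h _]].
have h' : 9 / 10 <= `|(orbit q n).2| by have := @saddle_coord_gt1 R; lra.
have : (9 / 10) ^+ 2 <= `|(orbit q n).2| ^+ 2 by rewrite ler_sqr ?nnegrE//; lra.
rewrite real_normK ?num_real//; lra.
Qed.

Definition disc (c : R) s :=
  cabs R (s.1 - c%:C) <= 1 / 4 /\ cabs R (s.2 - c%:C) <= 1 / 4.

(** At a sink c with c^2 = 1/4 the derivative of 3y/4 - y^3 vanishes, so the deviation of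
the new coordinate is half the old one plus terms of second order. *)
Lemma disc_step (c : R) s : c ^+ 2 = 1 / 4 -> disc c s -> disc c (fC R s).
Proof.
move: s => [s1 s2] c2 [/= h1 h2]; split => //.
have c1 : `|c| = 1 / 2.
  apply/eqP; rewrite -(@eqrXn2 _ 2)// ?divr_ge0// real_normK ?num_real// c2.
  by apply/eqP; field.
have d2 : c%:C ^+ 2 = 1 / 4 :> R[i] by rewrite -rmorphXn c2 fmorph_div rmorph1 rmorph_nat.
have d3 : c%:C ^+ 3 = c%:C / 4 by rewrite exprSr d2; field.
have [x xE] : exists x, s1 = x + c%:C by exists (s1 - c%:C); rewrite subrK.
have [y yE] : exists y, s2 = y + c%:C by exists (s2 - c%:C); rewrite subrK.
move: h1 h2; rewrite xE yE !addrK => h1 h2.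
have -> : (fC R (x + c%:C, y + c%:C)).2 - c%:C =
    (1 / 2 : R)%:C * x - (y * y) * ((3 * c)%:C + y).
  rewrite -half_complex rmorphM rmorph_nat /fC /henon /=; move: (c%:C) d2 d3 => d d2 d3.
  rewrite (_ : (y + d) ^+ 3 = y ^+ 3 + 3 * y ^+ 2 * d + 3 * y * d ^+ 2 + d ^+ 3);
    last by ring.
  by rewrite d2 d3; field.
apply: le_trans (cabsB _ _ _) _; rewrite cabsZ ger0_norm; last lra.
rewrite !cabsM; have h3 : cabs R ((3 * c)%:C + y) <= 7 / 4.
  apply: le_trans (cabsD _ _ _) _; rewrite cabs_real normrM c1 ger0_norm//; lra.
have h4 : cabs R y * cabs R y <= 1 / 4 * (1 / 4) by rewrite ler_pM ?cabs_ge0.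
have : cabs R y * cabs R y * cabs R ((3 * c)%:C + y) <= 1 / 4 * (1 / 4) * (7 / 4).
  by rewrite ler_pM ?mulr_ge0 ?cabs_ge0.
lra.
Qed.

Lemma disc_Kplus (c : R) s : c ^+ 2 = 1 / 4 -> disc c s -> Kplus R s.
Proof.
move=> c2 ds; apply/bounded_orbitP; exists (1 / 4 + `|c|) => n.
have [h1 h2] : disc c (iter n (fC R) s).
  by elim: n => [//|n IH]; rewrite iterS; exact: disc_step.
rewrite /cnorm ge_max; apply/andP; split.
  rewrite -[X in cabs R X](subrK c%:C); apply: le_trans (cabsD _ _ _) _.
  by rewrite cabs_real lerD2r.
rewrite -[X in cabs R X](subrK c%:C); apply: le_trans (cabsD _ _ _) _.
by rewrite cabs_real lerD2r.
Qed.

Lemma Kplus_shift s n : Kplus R (iter n (fC R) s) -> Kplus R s.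
Proof.
elim: n => [//|n IH] /bounded_orbitP[M hM]; apply: IH; apply/bounded_orbitP.
exists (cnorm R (iter n (fC R) s) + M) => -[|k].
  by rewrite lerDl (le_trans _ (hM 0%N))// cnorm_ge0.
by rewrite iterSr -iterS (le_trans (hM k))// lerDr cnorm_ge0.
Qed.

(** The orbit of the real point enters the invariant polydisc around (c, c), and so do
the orbits of all complex points near it. *)
Lemma sink_interior (c : R) q : c ^+ 2 = 1 / 4 ->
  orbit q n @[n --> \oo] --> (c, c) -> (Kplus R)° (real_pt R q).
Proof.
move=> c2 /cvg_coordP[/cvgrPdistC_le/(_ (1 / 8) ltac:(lra))[N1 _ h1]].
move=> /cvgrPdistC_le/(_ (1 / 8) ltac:(lra))[N2 _ h2].
pose N := maxn N1 N2.
have := iter_near R (fC R) (real_pt R q) N (1 / 8) (@fC_continuous R) ltac:(lra).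
apply: filterS => t; rewrite -real_pt_orbit => ht.
apply: (@Kplus_shift t N); apply: (@disc_Kplus c) => //.
have [k1 k2] := cnorm_ge R (iter N (fC R) t - real_pt R (orbit q N)).
split.
  rewrite -[X in cabs R X](subrKA (orbit q N).1%:C); apply: le_trans (cabsD _ _ _) _.
  rewrite -rmorphB cabs_real; have := h1 N (leq_maxl _ _); rewrite /= in k1 *; lra.
rewrite -[X in cabs R X](subrKA (orbit q N).2%:C); apply: le_trans (cabsD _ _ _) _.
rewrite -rmorphB cabs_real; have := h2 N (leq_maxr _ _); rewrite /= in k2 *; lra.
Qed.

Lemma Omega_interior q : Omega_plus R q \/ Omega_minus R q -> (Kplus R)° (real_pt R q).
Proof. by move=> [] h; apply: sink_interior h; rewrite ?sqrrN; field. Qed.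

End RealSlices.

(** * The real slices *)

Section Assembly.
Variable R : realType.
Local Notation a := (Num.sqrt (5 : R) / 2).
Local Notation orbit q n := (iter n (fR R) q).
Local Notation back q n := (iter n (fRinv R) q).
Implicit Types (q v : R * R).

Lemma Kplus_slice : real_slice (Kplus R) =
  Omega_plus R `|` Omega_minus R `|` Ws0 R `|` Wspp' R.
Proof.
apply/seteqP; split=> q.
  move=> /Kplus_real/forward_bounded_cvg[];
    by [left; left; left|left; left; right|left; right|right].
move=> h; apply/Kplus_real; case: h => [[[|]|]|]; last exact: Wspp'_bounded.
all: exact: cvg_forward_bounded.
Qed.

Lemma saddle_history_backward_bounded q : saddle_history R q -> backward_bounded R q.
Proof.
move=> [_ h _]; have /cvg_seq_bounded/pinfty_ex_gt0[M M0 hM] := cvgP _ h.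
by exists M => n; have := hM n I; rewrite /= normr_id.
Qed.

Lemma box_backward_bounded q : (forall n, box R (back q n)) -> backward_bounded R q.
Proof. by move=> b; exists (9 / 10) => n; have [_] := box_le1 _ _ (b n). Qed.

Lemma Kminus_slice : real_slice (Kminus R) = closure (Wu0 R) `|` Wupp' R.
Proof.
apply/seteqP; split=> q.
  move=> /Kminus_real/backward_bounded_cases[b|s]; [left|right].
    by rewrite closure_Wu0.
  exact/Wupp'_history.
rewrite closure_Wu0 => h; apply/Kminus_real; case: h => [|/Wupp'_history].
  exact: box_backward_bounded.
exact: saddle_history_backward_bounded.
Qed.

Lemma box_bounded q : box R q -> forward_bounded R q.
Proof. by move=> b; apply: inner_bounded; left. Qed.

Lemma saddle_stable_unstable c : saddle_pt R c -> Wspp' R c /\ Wupp' R c.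
Proof.
have fs : forall q, saddle_pt R q -> saddle_pt R (fR R q).
  have [e1 e2] := fRinv_saddle R.
  by move=> q [->|->]; [right; rewrite -e2|left; rewrite -e1]; exact: henon_invK.
have bs : forall q, saddle_pt R q -> saddle_pt R (fRinv R q).
  by have [e1 e2] := fRinv_saddle R; move=> q [->|->]; [right|left].
have ns (h : nat -> R * R) : (forall n, saddle_pt R (h n)) ->
    dist_set R (h n) [set p R; p' R] @[n --> \oo] --> (0 : R).
  move=> hs; apply/dist_saddles_cvg => e e0; apply: nearW => n.
  have [[h1 h2]|[h1 h2]] := saddle_near0 _ _ (hs n); [left|right];
    by split; apply: le_trans (ltW e0).
by move=> cs; split; apply: ns; elim=> [//|n IH]; rewrite iterS; [exact: fs|exact: bs].
Qed.

(** Points of positive [branch_sign] are outer, and outer points with bounded forward orbit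
are saddles. *)
Lemma saddle_history_cases q : saddle_history R q -> forward_bounded R q ->
  branch_sign R q < 0 \/ saddle_pt R q.
Proof.
move=> [_ _ io] b; have [|h|h] := ltgtP (branch_sign R q) 0; first by left.
  case: io => [/branch_sign_inner|/outer_bounded/(_ b)]; last by right.
  by rewrite leNgt h.
by right; apply: branch_sign_eq0.
Qed.

Lemma branch_sign_lt0_inner q : saddle_history R q -> branch_sign R q < 0 -> inner R q.
Proof. by move=> [_ _ [//|/branch_sign_outer]]; rewrite leNgt => /negbTE ->. Qed.

Lemma Jplus_slice : real_slice (Jplus R) = Ws0 R `|` Wspp' R.
Proof.
apply/seteqP; split=> q.
  move=> [cq nq]; have : real_slice (Kplus R) q by exact: Kplus_closed.
  rewrite Kplus_slice => -[[[w|w]|w]|w]; [exfalso|exfalso|by left|by right].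
    by apply: nq; apply: Omega_interior; left.
  by apply: nq; apply: Omega_interior; right.
move=> h; split.
  apply: subset_closure; suff : real_slice (Kplus R) q by [].
  by rewrite Kplus_slice; case: h => ?; [left; right|right].
by case: h; [exact: Ws0_not_interior|exact: Wspp'_not_interior].
Qed.

Lemma Jminus_slice : real_slice (Jminus R) = real_slice (Kminus R).
Proof.
apply/seteqP; split=> q; first by move=> [cq _]; exact: Kminus_closed.
by move=> h; split; [exact: subset_closure|exact: Kminus_interior0].
Qed.

Lemma Ws0_orig : Ws0 R (orig R).
Proof.
rewrite /Ws0 /= (_ : (fun n => orbit (orig R) n) = fun=> orig R); first exact: cvg_cst.
by apply/funext => n; exact: orbit0.
Qed.

Lemma Wu0_orig : Wu0 R (orig R).
Proof.
rewrite /Wu0 /= (_ : (fun n => back (orig R) n) = fun=> orig R); first exact: cvg_cst.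
apply/funext; elim=> [//|n IH]; rewrite iterS IH /fRinv /henon_inv /orig /=.
by rewrite expr0n /= !mulr0 subr0 addr0.
Qed.

End Assembly.

Theorem theorem4p1 (R : realType) (v v' : R * R) (Gamma Gamma' : R -> R * R)
  (hGamma : unstable_param (p R) (Q3 R) v Gamma)
  (hGamma' : unstable_param (p' R) (Q3' R) v' Gamma') :
  [/\ real_slice (K R) =
        closure (Wu0 R) `|` Wu_neg Gamma Gamma' `|` [set p R; p' R],
      real_slice (Kplus R) =
        Omega_plus R `|` Omega_minus R `|` Ws0 R `|` Wspp' R,
      real_slice (Kminus R) = closure (Wu0 R) `|` Wupp' R &
  [/\ real_slice (Jplus R) = Ws0 R `|` Wspp' R,
      real_slice (Jminus R) = real_slice (Kminus R) &
      real_slice (J R) =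
        [set orig R; p R; p' R] `|` (Wu_neg Gamma Gamma' `&` Ws0 R)]].
Proof.
have WuE := Wu_negE _ _ _ _ _ hGamma hGamma'.
have saddleE q : [set p R; p' R] q <-> saddle_pt R q by [].
split; [|exact: Kplus_slice|exact: Kminus_slice|split;
         [exact: Jplus_slice|exact: Jminus_slice|]].
- rewrite WuE; apply/seteqP; split=> q.
    move=> [/Kplus_real qp qm]; have : real_slice (Kminus R) q by [].
    rewrite Kminus_slice => -[c|/Wupp'_history s]; first by left; left.
    by have [n|n] := saddle_history_cases _ _ s qp; [left; right|right].
  move=> h; suff [fb km] : forward_bounded R q /\ real_slice (Kminus R) q.
    by split=> //; exact/Kplus_real.
  rewrite Kminus_slice; case: h => [[c|[s n]]|c].
  + split; last by left.
    by move: c; rewrite closure_Wu0 => /(_ 0%N); exact: box_bounded.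
  + split; last by right; exact/Wupp'_history.
    by apply: inner_bounded; exact: branch_sign_lt0_inner.
  + have [s u] := saddle_stable_unstable _ _ c.
    by split; [exact: Wspp'_bounded|right].
- rewrite WuE.
  have -> : real_slice (J R) = real_slice (Jplus R) `&` real_slice (Jminus R) by [].
  rewrite Jplus_slice Jminus_slice Kminus_slice closure_Wu0; apply/seteqP; split=> q.
    move=> [st [b|/Wupp'_history u]].
      case: st => [w|w]; last by case: (box_not_Wspp' _ _ (b 0%N) w).
      by left; left; left; exact: box_Ws0 (b 0%N) w.
    have fb : forward_bounded R q.
      by case: st => [w|w]; [exact: cvg_forward_bounded w|exact: Wspp'_bounded].
    have sd : saddle_pt R q -> ([set orig R; p R; p' R] `|`
        ([set q | saddle_history R q /\ branch_sign R q < 0] `&` Ws0 R)) q.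
      by move=> [->|->]; left; [left; right|right].
    have [n|] := saddle_history_cases _ _ u fb; last exact: sd.
    case: st => [w|w]; first by right.
    by apply: sd; apply: inner_Wspp' w; exact: branch_sign_lt0_inner.
  move=> [[[->|]|]|[[s n] w]].
  + split; first by left; exact: Ws0_orig.
    by left; exact: Wu0_box (Wu0_orig R).
  + by move=> ->; have [] := saddle_stable_unstable R (p R) (or_introl erefl); split; right.
  + by move=> ->; have [] := saddle_stable_unstable R (p' R) (or_intror erefl); split; right.
  + by split; [left|right; exact/Wupp'_history].
Qed.
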